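(* Let $N=\sum_{i=1}^t n_ir_i$ with positive integers $n_i,r_i$. For each $i$ let $\tau_0^{(i)}$ be an irreducible cuspidal representation of $\operatorname{GL}_{r_i}(\mathbb F_q)$ (the one occurring in the type $(K_{r_i},\tau_0^{(i)})$ of an irreducible depth-zero supercuspidal representation $\tau^{(i)}$ of $\operatorname{GL}_{r_i}(F)$), and assume $\tau_0^{(i)}\not\cong\tau_0^{(j)}$ for $i\neq j$. Put $\rho_i=(\tau_0^{(i)})^{\otimes n_i}$, and for partitions $\lambda_i\vdash n_i$ put $$V_{\lambda_1,\lambda_2,\dots,\lambda_t}=V^{(\rho_1)}_{\lambda_1}\times V^{(\rho_2)}_{\lambda_2}\times\cdots\times V^{(\rho_t)}_{\lambda_t}.$$ Then the representation $V_{\lambda_1,\lambda_2,\dots,\lambda_t}$ of $\operatorname{GL}_N(\mathbb F_q)$ is irreducible. Moreover, if $(\lambda_1,\dots,\lambda_t)\ne(\mu_1,\dots,\mu_t)$, then $V_{\lambda_1,\dots,\lambda_t}\not\cong V_{\mu_1,\dots,\mu_t}$.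
   Context: $F$ is a non-Archimedean local field with residue field $\mathbb F_q$; $K_m=\operatorname{GL}_m(\mathcal O_F)$; $G_m^F=\operatorname{GL}_m(\mathbb F_q)$; representations are complex. $(K_{r_i},\tau_0^{(i)})$ being the type of $\tau^{(i)}$ means that $\tau^{(i)}$ is compactly induced from an extension to $F^\times K_{r_i}$ of the inflation of $\tau_0^{(i)}$. The symbol $\times$ denotes Harish-Chandra (parabolic) induction to $\operatorname{GL}_N(\mathbb F_q)$ from the block upper triangular parabolic with Levi $\prod_i\operatorname{GL}_{n_ir_i}(\mathbb F_q)$. The representations $V^{(\rho_i)}_\lambda$. Fix $i$ and write $n=n_i$, $r=r_i$, $\tau_0=\tau_0^{(i)}$, $\rho=\rho_i=\tau_0^{\otimes n}$ on a space $W$. Let $P^F=M^FU^F$ be the block upper triangular parabolic of $G_{nr}^F$ with Levi $M^F=\operatorname{GL}_r(\mathbb F_q)^n$. Let $H=\operatorname{End}_{G_{nr}^F}(\operatorname{Ind}_{P^F}^{G_{nr}^F}\rho)^{\mathrm{op}}$, acting on $\operatorname{Hom}_{G_{nr}^F}(\operatorname{Ind}_{P^F}^{G_{nr}^F}\rho,X)$ by $h\cdot f=f\circ h$. Realize $\operatorname{Ind}_{P^F}^{G_{nr}^F}\rho=\mathbb C[G_{nr}^F]e_{U^F}\otimes_{\mathbb C[M^F]}W$ with $e_{U^F}=|U^F|^{-1}\sum_{u\in U^F}u$. View $w\in S_n$ as a block permutation matrix with blocks $0$ or $I_r$, and let $\gamma_w$ be the permutation of the tensor factors of $W$ with $\gamma_w(\rho(m)v)=\rho(w^{-1}mw)\gamma_w(v)$.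 For a simple reflection $s$ of $S_n$, $T_s\in H$ is the unique scalar multiple of $ge_{U^F}\otimes v\mapsto ge_{U^F}se_{U^F}\otimes\gamma_s(v)$ satisfying $T_s^2=(q^r-1)T_s+q^r$. These generate $H$ and identify $H$ with the Iwahori--Hecke algebra $\mathcal H(S_n,q^r)$. Simple $\mathcal H(S_n,q^r)$-modules correspond to irreducible representations of $S_n$, i.e. partitions of $n$, through specialization of the Hecke parameter to $1$; $(n)$ corresponds to $T_s\mapsto q^r$ and $(1^n)$ to $T_s\mapsto-1$. $V^{(\rho_i)}_\lambda$ is the irreducible constituent of $\operatorname{Ind}_{P^F}^{G_{nr}^F}\rho$ such that $\operatorname{Hom}_{G_{nr}^F}(\operatorname{Ind}_{P^F}^{G_{nr}^F}\rho,V^{(\rho_i)}_\lambda)$ is the simple module attached to $\lambda$. *)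

(* Defs.v *)
From HB Require Import structures.
From mathcomp Require Import all_boot all_order all_algebra all_fingroup.
From mathcomp Require Import all_character.

Set Implicit Arguments.
Unset Strict Implicit.
Unset Printing Implicit Defensive.

Import GroupScope GRing.Theory.
Local Open Scope ring_scope.

(* Representations are mathcomp's mx_representations; their modules are spaces
   of row vectors, on which the group acts on the right.  A left C[G]-module X
   is read as the right module x g := g^-1 x; under this dictionary
   C[G] e_U (x) W becomes W (x) e_U C[G], and linear maps between modules
   become right multiplications by matrices.  Hence a product A *m B of
   matrices of endomorphisms is the product of End(...)^op. *)

Section Induction.

Variables (C : fieldType) (gT : finGroupType) (G P : {group gT}) (d : nat).
Variable rP : mx_representation C P d.

Definition coset_rep (i : 'I_#|rcosets P G|) : gT := repr (enum_val i).

Definition ext0 (x : gT) : 'M[C]_d := if x \in P then rP x else 0.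

Definition ind_dim : nat := (\sum_(i < #|rcosets P G|) d)%N.

(* The vector v (x) g of W (x)_{C[P]} C[G], where W is the module of rP: it has
   coordinates v * p in the summand W (x) t_j, where g = p * t_j. *)
Definition ind_tens (v : 'rV[C]_d) (g : gT) : 'rV[C]_ind_dim :=
  \mxrow_j (v *m ext0 (g * (coset_rep j)^-1)%g).

(* Matrix of (v (x) t_i) g = v (x) (t_i g). *)
Definition ind_mx (g : gT) : 'M[C]_ind_dim :=
  \mxblock_(i, j) ext0 (coset_rep i * g * (coset_rep j)^-1)%g.

Lemma ext0M p x : p \in P -> ext0 (p * x)%g = rP p *m ext0 x.
Proof.
move=> Pp; rewrite /ext0 groupMl //.
by case: ifP => Px; rewrite ?mulmx0 ?repr_mxM.
Qed.

Lemma ind_tens_bal p v g : p \in P -> ind_tens v (p * g)%g = ind_tens (v *m rP p) g.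
Proof.
by move=> Pp; apply/eq_mxrow => j; rewrite -mulgA ext0M // mulmxA.
Qed.

Lemma coset_rep_in i x : x \in G ->
  exists j, (coset_rep i * x * (coset_rep j)^-1)%g \in P.
Proof.
move=> Gx; have /rcosetsP[y Gy defi] := enum_valP i.
have Pxy : P :* (y * x) \in rcosets P G.
  by apply/rcosetsP; exists (y * x)%g; rewrite ?groupM.
exists (enum_rank_in Pxy (P :* (y * x))).
rewrite /coset_rep enum_rankK_in // defi.
have /rcosetP[p Pp ->] := mem_repr_rcoset P y.
have /rcosetP[p' Pp' ->] := mem_repr_rcoset P (y * x).
by rewrite invMg -[(p * y * x)%g]mulgA -[X in X \in P]mulgA mulKVg groupM ?groupV.
Qed.

Lemma coset_rep_inj i j : (coset_rep i * (coset_rep j)^-1)%g \in P -> i = j.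
Proof.
have /rcosetsP[y _ defi] := enum_valP i; have /rcosetsP[z _ defj] := enum_valP j.
rewrite /coset_rep -mem_rcoset => Pij; apply: enum_val_inj.
have yi : repr (enum_val i) \in enum_val i by rewrite defi mem_repr_rcoset.
have zj : repr (enum_val j) \in enum_val j by rewrite defj mem_repr_rcoset.
move: yi zj Pij; move: (repr _) (repr _) => a b.
by rewrite defi defj => /rcoset_eqP<- /rcoset_eqP<- /rcoset_eqP->.
Qed.

Lemma ind_mx_repr : mx_repr G ind_mx.
Proof.
split=> [|x y Gx Gy].
  rewrite /ind_mx -mxdiagZ; apply/eq_mxblockP => i j; rewrite mulg1.
  rewrite /ext0; case: (eqVneq i j) => [<-|neq].
    by rewrite mulgV group1 repr_mx1 conform_mx_id.
  by case: ifP => // /coset_rep_inj eq_ij; rewrite eq_ij eqxx in neq.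
rewrite /ind_mx mul_mxblock; apply/eq_mxblockP => i k.
have [j Pj] := coset_rep_in i Gx.
rewrite (bigD1 j) //= big1 ?addr0 => [|l neq_lj]; last first.
  rewrite {1}/ext0; case: ifP => [Pl|_]; last by rewrite mul0mx.
  case/eqP: neq_lj; apply: coset_rep_inj.
  have := groupM (groupVr Pl) Pj; rewrite !invMg !invgK !mulgA.
  by rewrite !mulgKV.
rewrite {2}/ext0 Pj /ext0.
have -> : (coset_rep i * (x * y) * (coset_rep k)^-1 =
  (coset_rep i * x * (coset_rep j)^-1) * (coset_rep j * y * (coset_rep k)^-1))%g.
  by rewrite !mulgA mulgKV.
rewrite (groupMl _ Pj); case: ifP => Pk; last by rewrite mulmx0.
by rewrite repr_mxM.
Qed.

Definition ind_repr := MxRepresentation ind_mx_repr.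

End Induction.

Section Tensor.

Variables (C : fieldType) (t : nat) (d : 'I_t -> nat).

(* The standard basis of the tensor product of the C^(d i) is indexed by the
   product of the 'I_(d i); tens_ix a i is the i-th component of index a. *)
Definition tens_dim : nat := #|{: fprod (fun i : 'I_t => 'I_(d i))}|.

Definition tens_ix (a : 'I_tens_dim) : forall i, 'I_(d i) :=
  (enum_val a : fprod _).

Definition tens_mx (A : forall i, 'M[C]_(d i)) : 'M[C]_tens_dim :=
  \matrix_(a, b) \prod_i A i (tens_ix a i) (tens_ix b i).

Lemma eq_tens_mx A B : (forall i, A i = B i) -> tens_mx A = tens_mx B.
Proof.
by move=> eqAB; apply/matrixP=> a b; rewrite !mxE; apply: eq_bigr=> i _; rewrite eqAB.
Qed.

Lemma tens_mx1 : tens_mx (fun i => 1%:M) = 1%:M.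
Proof.
apply/matrixP => a b; rewrite !mxE.
have [<-|neq] := eqVneq a b; first by rewrite big1 // => i _; rewrite mxE eqxx.
have [/forallP eqab|/forallPn[i neqi]] :=
  boolP [forall i, tens_ix a i == tens_ix b i].
  by case/eqP: neq; apply/enum_val_inj/fprodP => i; apply/eqP/eqab.
by rewrite (bigD1 i) //= mxE (negPf neqi) mul0r.
Qed.

Lemma tens_mxM (A B : forall i, 'M[C]_(d i)) :
  tens_mx A *m tens_mx B = tens_mx (fun i => A i *m B i).
Proof.
apply/matrixP => a c; rewrite !mxE.
pose T (i : 'I_t) : finType := 'I_(d i).
pose E i : {ffun T i -> C} := [ffun j => A i (tens_ix a i) j * B i j (tens_ix c i)].
transitivity (\sum_(f : fprod T) \prod_(i in 'I_t) E i (f i)).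
  rewrite [RHS](reindex _ (onW_bij _ (@enum_val_bij _))) /=.
  apply: eq_bigr => b _; rewrite !mxE -big_split /=.
  by apply: eq_bigr => i _; rewrite ffunE.
rewrite big_fprod; apply/esym.
transitivity (\prod_i \sum_(j in tagged_with T i) untag 0 (E i) j).
  apply: eq_bigr => i _; rewrite -(big_tag (fun k => E k)) mxE.
  by apply: eq_bigr => j _; rewrite ffunE.
exact: (bigA_distr_big_dep (fun i => mem (tagged_with T i))).
Qed.

End Tensor.

Section Parabolic.

Variables (F : finFieldType) (N t : nat) (s : 'I_t -> nat).

(* The carrier of {'GL_m[F]} consists of matrices of size m.-1.+1, which is m
   for positive m; conform_mx 0 is the corresponding change of type. *)
Definition GLmx m k (g : {'GL_m[F]}) : 'M[F]_k := conform_mx 0 (GLval g).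

Definition mxGL m k (A : 'M[F]_k) : {'GL_m[F]} :=
  insubd (1%g : {'GL_m[F]}) (conform_mx 0 A : 'M_m.-1.+1).

(* The (i, j) block of g for the composition N = \sum_i s i. *)
Definition GLblock (g : {'GL_N[F]}) (i j : 'I_t) : 'M[F]_(s i, s j) :=
  submxblock (GLmx (\sum_k s k) g) i j.

Definition parabolic : {set {'GL_N[F]}} :=
  [set g | [forall i : 'I_t, forall j : 'I_t, (j < i)%N ==> (GLblock g i j == 0)]].

Definition unipotent : {set {'GL_N[F]}} :=
  [set g in parabolic | [forall i, GLblock g i i == 1%:M]].

Definition levi_part (g : {'GL_N[F]}) (i : 'I_t) : {'GL_(s i)[F]} :=
  mxGL (s i) (GLblock g i i).

Lemma parabolicP g :
  reflect (forall i j : 'I_t, (j < i)%N -> GLblock g i j = 0) (g \in parabolic).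
Proof.
rewrite inE; apply: (iffP forallP) => [h i j lt_ji|h i].
  by apply/eqP; move: (h i) => /forallP/(_ j)/implyP/(_ lt_ji).
by apply/forallP => j; apply/implyP => /h->.
Qed.

Lemma GLmxM m k (g h : {'GL_m[F]}) : GLmx k (g * h) = GLmx k g *m GLmx k h.
Proof.
rewrite /GLmx GL_MxE; move: (GLval g) (GLval h) => A B.
have [eq_mk|neq_mk] := eqVneq m.-1.+1 k; last first.
  by rewrite !nonconform_mx ?mul0mx // neq_mk.
by case: _ / eq_mk; rewrite !conform_mx_id.
Qed.

Lemma GLblockM g h i k :
  GLblock (g * h) i k = \sum_j GLblock g i j *m GLblock h j k.
Proof.
rewrite /GLblock GLmxM.
rewrite -[GLmx _ g in LHS]submxblockK -[GLmx _ h in LHS]submxblockK.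
by rewrite mul_mxblock mxblockK.
Qed.

Lemma GLblock1 i j : N.-1.+1 = (\sum_k s k)%N ->
  GLblock 1 i j = if i == j then conform_mx 0 (1%:M : 'M_(s i)) else 0.
Proof.
move=> eq_N; rewrite /GLblock /GLmx GL_1E.
suff -> : conform_mx 0 (1 : 'M[F]_N.-1.+1) = 1%:M :> 'M_(\sum_k s k).
  by rewrite -mxdiagZ mxblockK.
by case: _ / eq_N; rewrite conform_mx_id.
Qed.

Lemma GLblock_neq g i j : N.-1.+1 != (\sum_k s k)%N -> GLblock g i j = 0.
Proof. by move=> neq; rewrite /GLblock /GLmx nonconform_mx ?neq // submxblock0. Qed.

Lemma parabolic_group_set : group_set parabolic.
Proof.
apply/group_setP; split=> [|g h /parabolicP Pg /parabolicP Ph].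
  apply/parabolicP => i j lt_ji.
  have [eq_N|neq_N] := eqVneq N.-1.+1 (\sum_k s k)%N; last exact: GLblock_neq.
  by rewrite GLblock1 //; case: eqVneq => // eq_ij; rewrite eq_ij ltnn in lt_ji.
apply/parabolicP => i k lt_ki; rewrite GLblockM big1 // => j _.
have [lt_ji|le_ij] := ltnP j i; first by rewrite Pg // mul0mx.
by rewrite Ph ?mulmx0 // (leq_trans lt_ki).
Qed.

Canonical parabolic_group := Group parabolic_group_set.

Lemma GLblockM_diag g h i : g \in parabolic -> h \in parabolic ->
  GLblock (g * h) i i = GLblock g i i *m GLblock h i i.
Proof.
move=> /parabolicP Pg /parabolicP Ph; rewrite GLblockM (bigD1 i) //= big1 ?addr0 //.
move=> j; rewrite neq_ltn => /orP[lt_ji|lt_ij]; first by rewrite Pg // mul0mx.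
by rewrite Ph // mulmx0.
Qed.

Lemma mxGL0 m k : mxGL m (0 : 'M[F]_k) = 1%g.
Proof.
have -> : mxGL m (0 : 'M[F]_k) = insubd (1%g : {'GL_m[F]}) (0 : 'M_m.-1.+1).
  congr insubd; have [eq_km|neq] := eqVneq k m.-1.+1; last by rewrite nonconform_mx ?neq.
  by case: _ / eq_km; rewrite conform_mx_id.
by rewrite /insubd insubN // unitr0.
Qed.

Lemma mxGLM m k (A B : 'M[F]_k) : A \in unitmx -> B \in unitmx ->
  mxGL m (A *m B) = (mxGL m A * mxGL m B)%g.
Proof.
have [eq_km|neq] := eqVneq k m.-1.+1; last first.
  have mxGL1 M : @mxGL m k M = 1%g.
    rewrite -(mxGL0 m k) /mxGL; congr insubd.
    by rewrite !nonconform_mx ?neq.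
  by rewrite !mxGL1 mulg1.
rewrite {}eq_km in A B * => uA uB; apply: val_inj; rewrite /mxGL !conform_mx_id.
rewrite val_insubd FinRing.val_unitM !val_insubd.
have ->: A \is a GRing.unit = true by exact: uA.
have ->: B \is a GRing.unit = true by exact: uB.
suff ->: A *m B \is a GRing.unit = true by [].
by rewrite -[LHS]/(A *m B \in unitmx) unitmx_mul uA.
Qed.

Lemma levi_part1 i : levi_part 1 i = 1%g.
Proof.
rewrite /levi_part; have [eq_N|neq] := eqVneq N.-1.+1 (\sum_k s k)%N; last first.
  by rewrite GLblock_neq // mxGL0.
rewrite GLblock1 // eqxx conform_mx_id.
have := mxGLM (s i) (unitmx1 F (s i)) (unitmx1 F (s i)).
by rewrite mulmx1 -[LHS]mulg1 => /mulgI<-.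
Qed.

Lemma levi_partM g h i : g \in parabolic -> h \in parabolic ->
  levi_part (g * h) i = (levi_part g i * levi_part h i)%g.
Proof.
move=> Pg Ph; have [eq_N|neq] := eqVneq N.-1.+1 (\sum_k s k)%N; last first.
  by rewrite /levi_part !GLblock_neq // mxGL0 mulg1.
have unit_diag x : x \in parabolic -> GLblock x i i \in unitmx.
  move=> Px; have := GLblockM_diag i Px (groupVr Px).
  rewrite mulgV GLblock1 // eqxx conform_mx_id => /esym/mulmx1_unit[] //.
by rewrite /levi_part GLblockM_diag // mxGLM ?unit_diag.
Qed.

End Parabolic.

Arguments parabolic F N {t} s.
Arguments parabolic_group F N {t} s.
Arguments unipotent F N {t} s.

Section HarishChandra.

Variables (C : fieldType) (F : finFieldType) (N t : nat) (s d : 'I_t -> nat).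
Variable X : forall i, mx_representation C 'GL_(s i)[F] (d i).

(* The external tensor product of the X i, inflated to the parabolic. *)
Definition levi_mx (g : {'GL_N[F]}) : 'M[C]_(tens_dim d) :=
  tens_mx (fun i => X i (levi_part s g i)).

Lemma levi_mx_repr : mx_repr (parabolic F N s) levi_mx.
Proof.
split=> [|g h Pg Ph]; rewrite /levi_mx.
  by rewrite -[RHS]tens_mx1; apply: eq_tens_mx => i; rewrite levi_part1 repr_mx1.
rewrite tens_mxM; apply: eq_tens_mx => i.
by rewrite levi_partM // repr_mxM ?inE.
Qed.

Definition levi_repr : mx_representation C (parabolic_group F N s) (tens_dim d) :=
  MxRepresentation levi_mx_repr.

Definition HC_dim : nat := ind_dim 'GL_N[F] (parabolic_group F N s) (tens_dim d).

Definition HC_ind : mx_representation C 'GL_N[F] HC_dim :=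
  ind_repr 'GL_N[F] levi_repr.

End HarishChandra.

Arguments HC_dim F N {t} s d.
Arguments HC_ind {C F} N {t s d} X.

Definition cuspidal (C : fieldType) (F : finFieldType) (r d : nat)
    (rG : mx_representation C 'GL_r[F] d) : Prop :=
  forall (t : nat) (s : 'I_t -> nat),
    (1 < t)%N -> (forall i, 0 < s i)%N -> (\sum_i s i = r)%N ->
    rfix_mx rG (unipotent F r s) = 0.

(* Isomorphism for representations of general linear groups of a priori
   different sizes: the sizes have to be equal. *)
Definition GL_rsim (C : fieldType) (F : finFieldType) (r r' d d' : nat)
    (rG : mx_representation C 'GL_r[F] d)
    (rG' : mx_representation C 'GL_r'[F] d') : Prop :=
  exists e : r = r',
    mx_rsim (ecast m (mx_representation C 'GL_m[F] d) e rG) rG'.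

Definition is_partition (n : nat) (la : seq nat) : bool :=
  [&& sorted geq la, 0%N \notin la & sumn la == n].

Section Specht.

Variables (C : fieldType) (n : nat) (la : seq nat).

Let Sn : {group 'S_n} := [set: 'S_n]%G.

(* The Young diagram of la is filled with 0, ..., n - 1 row by row, so that k
   lies in row reshape_index la k and column reshape_offset la k. *)
Definition row_stab : {set 'S_n} :=
  [set w : 'S_n | [forall k, reshape_index la (w k) == reshape_index la k]].

Definition col_stab : {set 'S_n} :=
  [set w : 'S_n | [forall k, reshape_offset la (w k) == reshape_offset la k]].

Definition young_symmetrizer : 'rV[C]_(gcard Sn) :=
  \sum_(x in row_stab) \sum_(y in col_stab)
    (-1) ^+ (y : bool) *: delta_mx 0 (gring_index Sn (x * y)%g).

Definition specht_repr :=
  submod_repr (cyclic_mx_module (regular_repr C Sn) young_symmetrizer).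

End Specht.

Lemma simple_refl_proof n (k : 'I_n.-1) : (k.+1 < n)%N.
Proof. by case: n k => [|n] [k]. Qed.

Definition simple_refl n (k : 'I_n.-1) : 'S_n :=
  tperm (Ordinal (ltnW (simple_refl_proof k))) (Ordinal (simple_refl_proof k)).

(* T k is the image of T_s for s = simple_refl k under a representation of the
   Hecke algebra of S_n with parameter q. *)
Definition hecke_rep (A : comNzRingType) (q : A) (n e : nat)
    (T : 'I_n.-1 -> 'M[A]_e) : Prop :=
  [/\ forall k, T k *m T k = (q - 1) *: T k + q%:M,
      forall k l : 'I_n.-1, l = k.+1 :> nat ->
        T k *m T l *m T k = T l *m T k *m T l
    & forall k l : 'I_n.-1, (k.+1 < l)%N -> T k *m T l = T l *m T k].

(* The simple module of the Hecke algebra with parameter q attached to la: the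
   specialization at 'X = q of a representation of the generic Hecke algebra
   over C['X] whose specialization at 'X = 1 is the representation of S_n
   attached to la. *)
Definition hecke_attached (C : fieldType) (n : nat) (la : seq nat) (q : C)
    (e : nat) (T : 'I_n.-1 -> 'M[C]_e) : Prop :=
  exists TX : 'I_n.-1 -> 'M[{poly C}]_e,
    [/\ hecke_rep 'X TX,
        exists E : mx_representation C [set: 'S_n] e,
          mx_rsim E (specht_repr C n la) /\
          forall k, map_mx (horner_eval 1) (TX k) = E (simple_refl k)
      & forall k, map_mx (horner_eval q) (TX k) = T k].

Section Labelled.

Variables (C : fieldType) (F : finFieldType) (n r d : nat).
Variable tau : mx_representation C 'GL_r[F] d.

Definition cusp_dim : nat := HC_dim F (n * r) (fun _ : 'I_n => r) (fun=> d).

(* Induction of tau^{(x) n} from the parabolic with Levi GL_r^n. *)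
Definition cusp_ind : mx_representation C 'GL_(n * r)[F] cusp_dim :=
  HC_ind (n * r) (fun _ : 'I_n => tau).

Definition cusp_tens (v : 'rV[C]_(tens_dim (fun _ : 'I_n => d)))
    (g : {'GL_(n * r)[F]}) : 'rV[C]_cusp_dim :=
  ind_tens 'GL_(n * r)[F] (levi_repr (n * r) (fun _ : 'I_n => tau)) v g.

Definition block_perm (w : 'S_n) : {'GL_(n * r)[F]} :=
  mxGL (n * r) (\mxblock_(i < n, j < n) ((i == w j)%:R%:M : 'M[F]_r)).

(* The permutation of tensor factors v_0 (x) ... |-> v_(w 0) (x) .... *)
Definition tens_perm (w : 'S_n) : 'M[C]_(tens_dim (fun _ : 'I_n => d)) :=
  \matrix_(a, b) [forall i, tens_ix b i == tens_ix a (w i)]%:R.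

Definition hecke_param : C := (#|F| ^ r)%:R.

(* T is T_s for s = simple_refl k, namely the multiple of
     v (x) e_U g |-> gamma_s(v) (x) e_U s e_U g
   satisfying the quadratic relation.  Under the identification of
   W (x)_{C[M]} e_U C[G] with W (x)_{C[P]} C[G], v (x) e_U g is v (x) g. *)
Definition is_hecke_op (k : 'I_n.-1) (T : 'M[C]_cusp_dim) : Prop :=
  let U := unipotent F (n * r) (fun _ : 'I_n => r) in
  let s := simple_refl k in
  (exists c : C, forall (v : 'rV_(tens_dim (fun _ : 'I_n => d))) g,
     cusp_tens v g *m T =
     c *: (#|U|%:R^-1 *:
           \sum_(u in U) cusp_tens (v *m tens_perm s) (block_perm s * u * g)%g)) /\
  T *m T = (hecke_param - 1) *: T + hecke_param%:M.

(* X is V_la: an irreducible constituent of the induced representation such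
   that Hom(induced representation, X), with basis b and T_s acting by
   f |-> f o T_s, is the Hecke module attached to la. *)
Definition is_labelled (la : seq nat) (e : nat)
    (X : mx_representation C 'GL_(n * r)[F] e) : Prop :=
  [/\ mx_irreducible X,
      exists (M : 'M_cusp_dim) (modM : mxmodule cusp_ind M),
        mxsimple cusp_ind M /\ mx_rsim (submod_repr modM) X
    & exists (T : 'I_n.-1 -> 'M_cusp_dim) (m : nat)
        (b : m.-tuple 'M[C]_(cusp_dim, e)) (A : 'I_n.-1 -> 'M[C]_m),
      [/\ forall k, is_hecke_op k (T k),
          free b /\
          (forall f, (f \in <<b>>%VS) <->
            (forall g, cusp_ind g *m f = f *m X g)),
          forall k (j : 'I_m), T k *m b`_j = \sum_i A k i j *: b`_i
        & hecke_attached la hecke_param A]].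

End Labelled.

(* Main.v *)
Require Import Defs.
From mathcomp Require Import all_boot all_order all_algebra all_fingroup.
From mathcomp Require Import all_solvable all_character.
From mathcomp Require Import complex reals.
From mathcomp Require Import zify ring.

Set Implicit Arguments.
Unset Strict Implicit.
Unset Printing Implicit Defensive.

Import GroupScope GRing.Theory Num.Theory.
Local Open Scope ring_scope.

(** The theorem is an instance of Harish-Chandra theory, in which intertwining
    operators between induced representations are controlled by their kernels.

    Irreducibility.  Let P be the parabolic with Levi the product L of the
    GL_(n_i r_i), let Q inside P be the parabolic with blocks of sizes r_i,
    each r_i repeated n_i times, and let T be the tensor product of all the
    cuspidal representations, inflated to Q.  An intertwiner f between the
    representations induced from V and V' is the same thing as a kernel, a
    function phi on GL_N with values in Hom(V, V') which is equivariant for P on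
    both sides.  It is enough to show that phi vanishes outside P: then f is
    given by the L-intertwiner phi(1) (ind_unit_hom), and Schur orthogonality on
    L (tens_schur_neq, tens_schur_scalar) says that phi(1) is a scalar when
    V = V', and is 0 as soon as some V_i and V'_i are not isomorphic.  Both
    HC_ind_irr and HC_ind_components follow.

    Since V_i and V'_i are constituents of the representation induced from
    tau_i^(x n_i), they receive, respectively have, Q-equivariant maps from and
    to T that generate, respectively cogenerate (frobenius_unit,
    frobenius_eval).  Composing with these maps replaces phi by a kernel psi
    with values in End(T), equivariant for Q.  By the Bruhat decomposition
    (bruhat) only the value of psi at a permutation matrix w matters.  If some
    block of Q is not mapped by w^-1 into a single block, the unipotent radical
    of a two-block parabolic of that GL_r fixes psi(w) on one side, and
    cuspidality gives psi(w) = 0 (kernel_split_block0).  Otherwise w permutes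
    the blocks, psi(w) intertwines the cuspidal factors along this permutation,
    and since tau_i and tau_j are not isomorphic for different i and j, psi(w)
    is 0 unless w is in P (kernel_perm0).

    Labels.  It remains to see that V_i determines its partition
    (labelled_inj).  The operators T_s are determined by their defining
    properties (hecke_op_unique), so isomorphic constituents give conjugate
    Hecke modules.  A Hecke module attached to la at the parameter q is the
    value at X = q of a module over the generic Hecke algebra whose value at
    X = 1 is the Specht module of la.  Tits' deformation argument is replaced by
    a comparison of invariants: for a partition mu, let J be the set of the
    simple reflections of the row stabilizer of mu.  The symmetrizer of J, the
    sum of the T_w over the parabolic subgroup of J, is defined over C[X], and
    with it the existence of a nonzero vector on which T_s acts as X for all s
    in J can be moved between X = 1 and X = q (invariants_transfer).  The Specht
    module of mu has such a vector (specht_invariants), and if that of la has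
    one then mu is dominated by la (specht_invariants_dominance).  So conjugate
    modules have labels that dominate each other, and the labels are equal. *)

(** * Tensor products of matrices *)

(** Distributivity of products over sums whose ranges depend on the index; all
    the facts on tensor products below are instances of it. *)
Lemma prod_sum_fprod (C : fieldType) (I : finType) (T : I -> finType)
    (E : forall i, T i -> C) :
  \prod_i \sum_(j : T i) E i j = \sum_(f : fprod T) \prod_i E i (f i).
Proof.
pose E' i : {ffun T i -> C} := [ffun j => E i j].
transitivity (\sum_(f : fprod T) \prod_(i in I) E' i (f i)); last first.
  by apply: eq_bigr => f _; apply: eq_bigr => i _; rewrite ffunE.
rewrite big_fprod.
transitivity (\prod_i \sum_(j in tagged_with T i) untag 0 (E' i) j).
  apply: eq_bigr => i _; rewrite -(big_tag (fun k => E' k)).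
  by apply: eq_bigr => j _; rewrite ffunE.
exact: (bigA_distr_big_dep (fun i => mem (tagged_with T i))).
Qed.

Section RTens.
Variables (C : fieldType) (t : nat).

(** Tensor products of linear maps between different spaces: the maps from and to
    the cuspidal representations are not square. *)
Definition rtens (d d' : 'I_t -> nat) (A : forall i, 'M[C]_(d i, d' i)) :
    'M[C]_(tens_dim d, tens_dim d') :=
  \matrix_(a, b) \prod_i A i (tens_ix a i) (tens_ix b i).

Lemma eq_rtens (d d' : 'I_t -> nat) (A B : forall i, 'M[C]_(d i, d' i)) :
  (forall i, A i = B i) -> rtens A = rtens B.
Proof.
by move=> eqAB; apply/matrixP=> a b; rewrite !mxE; apply: eq_bigr=> i _; rewrite eqAB.
Qed.

Lemma sum_tens_ix (d : 'I_t -> nat) (E : forall i, 'I_(d i) -> C) :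
  \sum_(a < tens_dim d) \prod_i E i (tens_ix a i) = \prod_i \sum_j E i j.
Proof.
rewrite prod_sum_fprod [RHS](reindex _ (onW_bij _ (@enum_val_bij _))) /=.
by apply: eq_bigr.
Qed.

Lemma rtensM (d d' d'' : 'I_t -> nat) (A : forall i, 'M[C]_(d i, d' i))
    (B : forall i, 'M[C]_(d' i, d'' i)) :
  rtens A *m rtens B = rtens (fun i => A i *m B i).
Proof.
apply/matrixP => a c; rewrite !mxE.
transitivity (\sum_(b < tens_dim d') \prod_i
    (A i (tens_ix a i) (tens_ix b i) * B i (tens_ix b i) (tens_ix c i))).
  by apply: eq_bigr => b _; rewrite !mxE -big_split.
rewrite (@sum_tens_ix d' (fun i j => A i (tens_ix a i) j * B i j (tens_ix c i))).
by apply: eq_bigr => i _; rewrite mxE.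
Qed.

Lemma rtens1 (d : 'I_t -> nat) : rtens (fun i => 1%:M : 'M_(d i)) = 1%:M.
Proof. exact: tens_mx1. Qed.

Lemma sum_rtens (d d' : 'I_t -> nat) (J : 'I_t -> finType)
    (B : forall i, J i -> 'M[C]_(d i, d' i)) :
  \sum_(f : fprod J) rtens (fun i => B i (f i)) = rtens (fun i => \sum_j B i j).
Proof.
apply/matrixP => a b; rewrite summxE mxE.
transitivity (\sum_(f : fprod J) \prod_i B i (f i) (tens_ix a i) (tens_ix b i)).
  by apply: eq_bigr => f _; rewrite mxE.
rewrite -(@prod_sum_fprod _ _ J (fun i j => B i j (tens_ix a i) (tens_ix b i))).
by apply: eq_bigr => i _; rewrite summxE.
Qed.

Definition slot (d : 'I_t -> nat) i (A : 'M[C]_(d i)) : 'M[C]_(tens_dim d) :=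
  tens_mx (dfwith (fun j => 1%:M) A).

(** As a linear function of A, each entry of [slot A] is a multiple of a single
    entry of A.  Therefore an identity between averages of entries of
    representation matrices passes to the tensor product entry by entry. *)
Lemma slot_entry (d : 'I_t -> nat) i a b : exists c : C, forall A : 'M[C]_(d i),
  slot A a b = c * A (tens_ix a i) (@tens_ix t d b i).
Proof.
exists (\prod_(j | j != i) (1%:M : 'M_(d j)) (tens_ix a j) (tens_ix b j)) => A.
rewrite mxE (bigD1 i) //= mulrC dfwith_in; congr (_ * _).
by apply: eq_bigr => j ne; rewrite dfwith_out // eq_sym.
Qed.

Lemma slotM (d : 'I_t -> nat) i (A B : 'M[C]_(d i)) : slot A *m slot B = slot (A *m B).
Proof.
rewrite /slot tens_mxM; apply: eq_tens_mx => j; case: (eqVneq i j) => [e|ne].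
  by case: _ / e; rewrite !dfwith_in.
by rewrite !dfwith_out // mulmx1.
Qed.

Lemma slot1 (d : 'I_t -> nat) i : slot (1%:M : 'M[C]_(d i)) = 1%:M.
Proof.
rewrite /slot -tens_mx1; apply: eq_tens_mx => j; case: (eqVneq i j) => [e|ne].
  by case: _ / e; rewrite !dfwith_in.
by rewrite !dfwith_out.
Qed.

End RTens.

(** * Coordinates on block matrices *)

Section Offset.
Variables (N t : nat) (s : 'I_t -> nat).

(** The position in the range of length N of the a-th element of the block i.  The
    carriers of the general linear groups have size [m.-1.+1], which is why the
    ordinals do. *)
Definition block_pos (i : 'I_t) (a : 'I_(s i).-1.+1) : 'I_N.-1.+1 :=
  inord (\sum_(k < t | (k < i)%N) s k + a).

Arguments block_pos : clear implicits.

Hypotheses (eN : (\sum_k s k = N)%N) (N0 : (0 < N)%N) (s0 : forall i, (0 < s i)%N).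

Let eN' : N.-1.+1 = (\sum_k s k)%N. Proof. by rewrite eN prednK. Qed.
Let ci i : 'I_(s i).-1.+1 -> 'I_(s i) := cast_ord (prednK (s0 i)).
Let cN : 'I_(\sum_k s k) -> 'I_N.-1.+1 := cast_ord (esym eN').

Lemma block_posE i a : block_pos i a = cN (@tagnat.Rank t s i (@ci _ a)).
Proof.
have E := @tagnat.RankEsum t s i (ci a).
have lt : (\sum_(k < t | (k < i)%N) s k + a < N.-1.+1)%N.
  by rewrite -E; exact: (ltn_ord (cN (@tagnat.Rank t s i (ci a)))).
by apply: val_inj; apply: (etrans (inordK lt)); rewrite -E.
Qed.

Lemma block_pos_val i a : block_pos i a = (\sum_(k < t | (k < i)%N) s k + a)%N :> nat.
Proof. by rewrite block_posE -[LHS]/(nat_of_ord (@tagnat.Rank t s i (ci a))) tagnat.RankEsum. Qed.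

Lemma block_pos_surj x : exists i a, x = block_pos i a.
Proof.
pose y : 'I_(\sum_k s k) := cast_ord eN' x.
exists (tagnat.sig1 y), (cast_ord (esym (prednK (s0 _))) (tagnat.sig2 y)).
by rewrite block_posE /ci cast_ordKV tagnat.sig2K /cN /y cast_ordK.
Qed.

Lemma block_pos_eq i j a b : (block_pos i a == block_pos j b) = (i == j) && (a == b :> nat).
Proof.
by rewrite !block_posE (inj_eq (@cast_ord_inj _ _ _)) -val_eqE /= tagnat.eq_Rank.
Qed.

Lemma block_pos_inj i : injective (block_pos i).
Proof. by move=> a b /eqP; rewrite block_pos_eq eqxx /= => /eqP/val_inj. Qed.

Lemma block_pos_lt (i j : 'I_t) a b : (i < j)%N -> (block_pos i a < block_pos j b)%N.
Proof.
move=> lt_ij; rewrite !block_pos_val /=.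
have -> : (\sum_(k < t | (k < j)%N) s k =
    \sum_(k < t | (k < i)%N) s k + \sum_(k < t | (k < j)%N && ~~ (k < i)%N) s k)%N.
  rewrite (bigID [pred k : 'I_t | (k < i)%N]) /=; congr (_ + _)%N.
  by apply: eq_bigl => k; case: (ltnP k i) => h1; rewrite ?andbF // (ltn_trans h1).
rewrite -addnA ltn_add2l (bigD1 i) /= ?lt_ij ?ltnn //.
by rewrite -addnA ltn_addr // -[X in (_ < X)%N]prednK.
Qed.

Lemma block_pos_ltE (i : 'I_t) a b : (block_pos i a < block_pos i b)%N = (a < b)%N.
Proof. by rewrite !block_pos_val ltn_add2l. Qed.

Variable F : finFieldType.
Implicit Type g : {'GL_N[F]}.

Lemma GLmxE m k (g : {'GL_m[F]}) (e : m.-1.+1 = k) x y :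
  GLmx k g (cast_ord e x) (cast_ord e y) = GLval g x y.
Proof.
rewrite /GLmx; case: _ / e => /=; rewrite !cast_ord_id conform_mx_id //.
Qed.

Lemma GLblockE g i j a b :
  GLblock s g i j (@ci _ a) (@ci _ b) = GLval g (block_pos i a) (block_pos j b).
Proof.
rewrite /GLblock mxE !block_posE /cN -(GLmxE g eN').
by rewrite !cast_ordKV.
Qed.

Lemma ci_surj i (a' : 'I_(s i)) : exists a, a' = ci a.
Proof. by exists (cast_ord (esym (prednK (s0 _))) a'); rewrite /ci cast_ordKV. Qed.

Lemma parabolicE g : reflect
  (forall (i j : 'I_t) a b, (j < i)%N -> GLval g (block_pos i a) (block_pos j b) = 0)
  (g \in parabolic F N s).
Proof.
apply: (iffP (parabolicP _ _)) => h i j.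
  by move=> a b /h; rewrite -GLblockE => ->; rewrite mxE.
move=> ltji; apply/matrixP=> a' b'; have [a ->] := ci_surj a'; have [b ->] := ci_surj b'.
by rewrite GLblockE h // mxE.
Qed.

Lemma mxGL_val m k (A : 'M[F]_k) (e : k = m.-1.+1) x y : A \in unitmx ->
  GLval (mxGL m A) (cast_ord e x) (cast_ord e y) = A x y.
Proof.
subst k => uA; rewrite /mxGL val_insubd conform_mx_id !cast_ord_id.
by have -> : A \is a GRing.unit = true by exact: uA.
Qed.

Lemma GLblock_unit g i : g \in parabolic F N s -> GLblock s g i i \in unitmx.
Proof.
move=> Px; have := GLblockM_diag i Px (groupVr (Px : g \in parabolic_group F N s)).
by rewrite mulgV GLblock1 // eqxx conform_mx_id => /esym/mulmx1_unit[].
Qed.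

Lemma levi_partE g i a b : g \in parabolic F N s ->
  GLval (levi_part s g i) a b = GLval g (block_pos i a) (block_pos i b).
Proof.
move=> Pg; rewrite /levi_part -GLblockE.
by rewrite -(mxGL_val (esym (prednK (s0 i)))) ?GLblock_unit // /ci !cast_ordK.
Qed.

Lemma unipotentE g : reflect
  (g \in parabolic F N s /\
   forall i a b, GLval g (block_pos i a) (block_pos i b) = (a == b)%:R) (g \in unipotent F N s).
Proof.
apply: (iffP setIdP) => -[Pg h]; split=> //.
  move=> i a b; rewrite -GLblockE (eqP (forallP h i)) mxE.
  by rewrite (inj_eq (@cast_ord_inj _ _ _)).
apply/forallP => i; apply/eqP/matrixP=> a' b'.
have [a ->] := ci_surj a'; have [b ->] := ci_surj b'.
by rewrite GLblockE h !mxE.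
Qed.

Lemma mxGL_block_pos (A : 'M[F]_(\sum_k s k)) i j a b : A \in unitmx ->
  GLval (mxGL N A) (block_pos i a) (block_pos j b) =
  submxblock A i j (cast_ord (prednK (s0 i)) a) (cast_ord (prednK (s0 j)) b).
Proof. by move=> uA; rewrite !block_posE mxGL_val // [RHS]mxE. Qed.

Lemma diagGL_exists (u : forall i, {'GL_(s i)[F]}) : exists g : {'GL_N[F]},
  [/\ g \in parabolic F N s, forall i, levi_part s g i = u i,
      forall i a b, GLval g (block_pos i a) (block_pos i b) = GLval (u i) a b
    & forall i j a b, i != j -> GLval g (block_pos i a) (block_pos j b) = 0].
Proof.
pose A := \mxdiag_i (GLmx (s i) (u i)).
pose B := \mxdiag_i (GLmx (s i) (u i)^-1%g).
have AB : A *m B = 1%:M.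
  rewrite mul_mxdiag_mxblock -mxdiagZ; apply/eq_mxblock => i j.
  case: (eqVneq i j) => [<-|_]; last by rewrite mulmx0.
  rewrite !conform_mx_id -GLmxM mulgV {j}.
  rewrite /GLmx GL_1E; have := prednK (s0 i); move: (_.-1.+1) => k e.
  by case: _ / e; rewrite conform_mx_id.
have [uA _] := mulmx1_unit AB.
have h1 i a b : GLval (mxGL N A) (block_pos i a) (block_pos i b) = GLval (u i) a b.
  by rewrite mxGL_block_pos // mxblockK eqxx conform_mx_id GLmxE.
have h2 i j a b : i != j -> GLval (mxGL N A) (block_pos i a) (block_pos j b) = 0.
  by move=> ne; rewrite mxGL_block_pos // mxblockK (negPf ne) mxE.
have P : mxGL N A \in parabolic F N s.
  by apply/parabolicE => i j a b lt; apply: h2; rewrite neq_ltn lt orbT.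
exists (mxGL N A); split=> // i; apply: val_inj; apply/matrixP => a b /=.
by rewrite levi_partE // h1.
Qed.

Lemma unipotent_levi g : reflect
  (g \in parabolic F N s /\ forall i, levi_part s g i = 1%g) (g \in unipotent F N s).
Proof.
apply: (iffP (unipotentE g)) => -[Pg h]; split=> // i.
  by apply: val_inj; apply/matrixP => a b /=; rewrite levi_partE // h mxE.
by move=> a b; rewrite -levi_partE // h GL_1E mxE.
Qed.

Lemma unipotent1 : 1%g \in unipotent F N s.
Proof.
apply/unipotent_levi; split=> [|i]; last exact: levi_part1.
exact: (group1 (parabolic_group F N s)).
Qed.

Lemma unipotentMr g h : h \in unipotent F N s ->
  ((g * h)%g \in unipotent F N s) = (g \in unipotent F N s).
Proof.
move=> /unipotent_levi[Ph h1].
have PM : ((g * h)%g \in parabolic F N s) = (g \in parabolic F N s).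
  exact: (groupMr _ (Ph : h \in parabolic_group F N s)).
apply/unipotent_levi/unipotent_levi; rewrite PM => -[Pg g1]; split=> // i.
  by rewrite -(g1 i) levi_partM // h1 mulg1.
by rewrite levi_partM // g1 h1 mulg1.
Qed.

(** The sum over a group is, up to a scalar, the projection onto the fixed vectors. *)
Lemma sum_unipotent0 (C : fieldType) d (X : mx_representation C 'GL_N[F] d) :
  rfix_mx X (unipotent F N s) = 0 -> \sum_(u in unipotent F N s) X u = 0.
Proof.
move=> fix0.
set S := \sum_(u in _) X u.
suff : (S <= rfix_mx X (unipotent F N s))%MS by rewrite fix0 submx0 => /eqP.
apply/rfix_mxP => v Uv; rewrite {}/S.
rewrite mulmx_suml [RHS](reindex_inj (mulIg v)) /=.
apply: eq_big => [u|u _]; first by rewrite unipotentMr.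
by rewrite repr_mxM ?inE.
Qed.

End Offset.

Arguments block_pos N {t} s i a.

Lemma GL_exists (F : finFieldType) m (A : 'M[F]_m.-1.+1) :
  A \in unitmx -> exists g : {'GL_m[F]}, GLval g = A.
Proof. by move=> uA; exists (Sub A uA). Qed.

(** * Bruhat decomposition *)

Definition upper (F : fieldType) n (A : 'M[F]_n) := forall i j : 'I_n, (j < i)%N -> A i j = 0.

(** By induction on the size.  In the first column the lowest nonzero entry is
    taken as a pivot: upper triangular row operations clear the column above it
    and upper triangular column operations clear its row, so that one can pass to
    the matrix without this row and this column. *)
Lemma bruhat (F : fieldType) n (A : 'M[F]_n) : A \in unitmx ->
  exists (b b' : 'M_n) (w : 'S_n), [/\ upper b, upper b' & A = b *m perm_mx w *m b'].
Proof.
elim: n A => [|n IHn] A uA.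
  by exists 1%:M, 1%:M, 1%g; split; [case|case|apply/matrixP; case].
have uA0 v : v *m A = 0 -> v = 0 :> 'rV_n.+1.
  by move=> /(congr1 (mulmxr (invmx A))) /=; rewrite mulmxK // mul0mx.
have [i Ai0 maxi] : exists2 i, A i 0 != 0 & forall k : 'I_n.+1, (i < k)%N -> A k 0 = 0.
  have /existsP[i0 Hi0] : [exists i, A i 0 != 0].
    rewrite -negb_forall; apply: contraL uA => /forallP h.
    rewrite unitmxE (expand_det_col _ 0) big1 ?unitr0 // => k _.
    by rewrite (eqP (h k)) mul0r.
  case: (@arg_maxnP _ i0 (fun i => A i 0 != 0) (fun i => i : nat) Hi0) => i Hi maxi.
  exists i => // k lt; apply/eqP; apply: contraLR lt => /maxi.
  by rewrite -leqNgt.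
pose p := A i 0.
pose H := \matrix_(k < n, l < n)
  (A (lift i k) (lift 0 l) - A (lift i k) 0 / p * A i (lift 0 l)).
have uH : H \in unitmx.
  rewrite -row_free_unit -kermx_eq0; apply/eqP/row_matrixP => r; rewrite row0.
  set v := row r _; have vH : v *m H = 0.
    by apply/sub_kermxP; exact: row_sub.
  pose u := \row_(x < n.+1) (if unlift i x is Some k then v 0 k
             else - \sum_k v 0 k * (A (lift i k) 0 / p)).
  have u_i : u 0 i = - \sum_k v 0 k * (A (lift i k) 0 / p) by rewrite mxE unlift_none.
  have u_l k : u 0 (lift i k) = v 0 k by rewrite mxE liftK.
    (* A vector v killed by H extends to a vector u killed by A. *)
have u0 : u = 0.
    apply: uA0; apply/rowP => y; rewrite mxE (bigD1_ord i) //= u_i [RHS]mxE.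
    rewrite [X in _ + X](eq_bigr (fun k => v 0 k * A (lift i k) y)) => [|k _]; last by rewrite u_l.
    have [l ->|->] := unliftP 0 y.
      have vHl : (v *m H) 0 l = 0 by rewrite vH mxE.
      apply: etrans vHl; rewrite [RHS]mxE.
      rewrite mulNr mulr_suml -sumrN -big_split /=; apply: eq_bigr => k _.
      by rewrite [H k l]mxE mulrBr addrC -[v 0 k * _ * _]mulrA.
    rewrite mulNr mulr_suml addrC; apply/eqP; rewrite subr_eq0; apply/eqP.
    by apply: eq_bigr => k _; rewrite -mulrA divfK.
  by apply/rowP => k; rewrite -u_l u0 !mxE.
have [b [b' [w [ub ub' defH]]]] := IHn H uH.
pose B := \matrix_(x < n.+1, y < n.+1)
  (if unlift i y is Some l then (if unlift i x is Some k then b k l else 0)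
   else A x 0 / p).
pose B' := \matrix_(x < n.+1, y < n.+1)
  (if unlift 0 x is Some k then (if unlift 0 y is Some l then b' k l else 0)
   else A i y).
exists B, B', (lift_perm i 0 w); split.
- move=> x y lt; rewrite mxE; have [l ey|ey] := unliftP i y; last first.
    by rewrite maxi ?mul0r // -ey.
  have [k ex|//] := unliftP i x; apply: ub; move: lt; by rewrite ex ey /= !ltnNge leq_bump2.
- move=> x y lt; rewrite mxE; have [k ex|ex] := unliftP 0 x; last first.
    by rewrite ex in lt.
  by have [l ey|//] := unliftP 0 y; apply: ub'; move: lt; rewrite ex ey.
apply/matrixP => x y; rewrite -mulmxA -row_permE mxE (bigD1_ord i) //=.
rewrite !mxE unlift_none lift_perm_id unlift_none.
under eq_bigr do rewrite !mxE liftK lift_perm_lift liftK.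
have [k ->|->] := unliftP i x; last first.
  by rewrite divff // mul1r big1 ?addr0 // => l _; rewrite mul0r.
have [l ->|->] := unliftP 0 y; last first.
  by rewrite divfK // big1 ?addr0 // => l _; rewrite mulr0.
have : H k l = (b *m perm_mx w *m b') k l by rewrite -defH.
rewrite -mulmxA -row_permE mxE => /eqP; rewrite subr_eq => /eqP->.
rewrite addrC mxE; congr (_ + _); apply: eq_bigr => z _.
by rewrite !mxE.
Qed.

(** * Schur orthogonality *)

Lemma mulmx_delta_entry (R : pzSemiRingType) m n p q (A : 'M[R]_(m, n)) (B : 'M_(p, q)) a b c d :
  (A *m delta_mx b c *m B) a d = A a b * B c d.
Proof.
rewrite mxE (bigD1 c) //= big1 ?addr0 => [|j ne]; last first.
  rewrite mxE big1 ?mul0r // => k _; rewrite mxE.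
  by rewrite (negPf ne) andbF mulr0.
congr (_ * _); rewrite mxE (bigD1 b) //= mxE !eqxx mulr1 big1 ?addr0 // => k ne.
by rewrite mxE (negPf ne) mulr0.
Qed.

Section Schur.
Variables (C : numClosedFieldType) (gT : finGroupType) (G : {group gT}).

(** Schur's lemma: the kernel and the image of X are submodules. *)
Lemma intertwiner_rsim n n' (rG : mx_representation C G n)
    (rG' : mx_representation C G n') (X : 'M_(n, n')) :
  mx_irreducible rG -> mx_irreducible rG' -> X != 0 ->
  (forall g, g \in G -> rG g *m X = X *m rG' g) -> mx_rsim rG rG'.
Proof.
move=> /mx_irrP[n0 irrG] /mx_irrP[n0' irrG'] X0 hX.
have freeX : row_free X.
  rewrite -kermx_eq0; apply/idPn => K0.
  have/irrG/(_ K0) : mxmodule rG (kermx X).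
    apply/mxmoduleP => g Gg; apply/sub_kermxP.
    by rewrite -mulmxA hX // mulmxA mulmx_ker mul0mx.
  rewrite -sub1mx => /sub_kermxP; rewrite mul1mx => X00.
  by rewrite X00 eqxx in X0.
have fullX : row_full X.
  rewrite -sub1mx; have := genmxE X => /eqmxP/andP[sgX _].
  apply: submx_trans sgX; rewrite sub1mx; apply: irrG'; last first.
    by rewrite -mxrank_eq0 genmxE mxrank_eq0.
  apply/mxmoduleP => g Gg; rewrite genmxE (eqmxMr _ (genmxE _)) -hX //.
  exact: submxMl.
by exists X => //; move/eqP: freeX => <-; apply/eqP.
Qed.

Lemma intertwiner_avg n n' (rG : mx_representation C G n)
    (rG' : mx_representation C G n') (X : 'M_(n, n')) g : g \in G ->
  let M := \sum_(h in G) rG h *m X *m rG' h^-1%g in rG g *m M = M *m rG' g.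
Proof.
move=> Gg /=; rewrite mulmx_sumr mulmx_suml.
rewrite [RHS](reindex_inj (mulgI g)) /=.
apply: eq_big => [h|h Gh]; first by rewrite groupMl.
by rewrite invMg !repr_mxM ?groupV // !mulmxA repr_mxKV.
Qed.

Lemma schur_avg_neq n n' (rG : mx_representation C G n)
    (rG' : mx_representation C G n') X :
  mx_irreducible rG -> mx_irreducible rG' -> ~ mx_rsim rG rG' ->
  \sum_(h in G) rG h *m X *m rG' h^-1%g = 0.
Proof.
move=> irr irr' nsim; apply/eqP/negPn/negP => M0.
by case: nsim; apply: (intertwiner_rsim irr irr' M0) => g /intertwiner_avg->.
Qed.

Lemma schur_orth_neq n n' (rG : mx_representation C G n)
    (rG' : mx_representation C G n') a b c d :
  mx_irreducible rG -> mx_irreducible rG' -> ~ mx_rsim rG rG' ->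
  \sum_(h in G) rG h a b * rG' h^-1%g c d = 0.
Proof.
move=> irr irr' nsim.
have /matrixP/(_ a d) := schur_avg_neq (delta_mx b c) irr irr' nsim.
rewrite summxE mxE => sum0; apply: etrans sum0; apply: eq_bigr => h _.
by rewrite mulmx_delta_entry.
Qed.

Lemma schur_orth_eq n (rG : mx_representation C G n) a b c d :
  mx_irreducible rG ->
  \sum_(h in G) rG h a b * rG h^-1%g c d =
    #|G|%:R / n%:R * (a == d)%:R * (b == c)%:R.
Proof.
move=> irr; pose M := \sum_(h in G) rG h *m delta_mx b c *m rG h^-1%g.
transitivity (M a d).
  by rewrite summxE; apply: eq_bigr => h _; rewrite mulmx_delta_entry.
have irrA := group_closure_closed_field irr.
have : is_scalar_mx M.
  apply: (mx_abs_irr_cent_scalar irrA).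
  by apply/centgmxP => g /intertwiner_avg->.
case/is_scalar_mxP => x defM.
have n0 : n%:R != 0 :> C.
  by case/mx_irrP: irr => n0 _; rewrite pnatr_eq0 -lt0n.
have trM : \tr M = #|G|%:R * (b == c)%:R.
  rewrite /M raddf_sum /= (eq_bigr (fun _ => (b == c)%:R)) => [|h Gh].
    by rewrite sumr_const mulr_natl.
  rewrite mxtrace_mulC mulmxA -repr_mxM ?groupV // mulVg repr_mx1 mul1mx.
  rewrite /mxtrace (bigD1 b) //= mxE eqxx /= big1 ?addr0 // => j ne.
  by rewrite mxE (negPf ne).
have defx : x = #|G|%:R * (b == c)%:R / n%:R.
  by rewrite -trM defM mxtrace_scalar -[x *+ n]mulr_natr mulfK.
rewrite defM mxE -[x *+ _]mulr_natr defx -!mulrA; congr (_ * _).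
by rewrite mulrC -mulrA.
Qed.

Lemma pchar_num : [pchar C]^'.-group G.
Proof. by rewrite /pgroup pcharf'_nat pnatr_eq0 -lt0n cardG_gt0. Qed.

(** By Maschke's theorem a submodule is the image of an equivariant projection. *)
Lemma scalar_cent_irr n (rG : mx_representation C G n) : (0 < n)%N ->
  (forall f, centgmx rG f -> is_scalar_mx f) -> mx_irreducible rG.
Proof.
move=> n0 scal; apply/mx_irrP; split=> // U modU U0.
have [W modW defV /mxdirect_addsP dx] := mx_Maschke_pchar rG pchar_num modU (submx1 U).
have : is_scalar_mx (proj_mx U W).
  apply: scal; apply/centgmxP => g Gg.
  have := proj_mx_hom dx modU modW; rewrite defV => /hom_mxP/(_ g Gg).
  by rewrite !mul1mx.
case/is_scalar_mxP => x defx.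
rewrite -sub1mx; apply: contraR U0 => nU.
have x0 : x = 0.
  apply: contraNeq nU => x0; have := proj_mx_sub U W 1%:M.
  by rewrite mul1mx defx => /(scalemx_sub x^-1); rewrite scale_scalar_mx mulVf.
have := proj_mx_id dx (submx_refl U).
by rewrite defx x0 -scalemx1 scale0r mulmx0 => <-.
Qed.

End Schur.

Lemma GL_conj_perm (F : finFieldType) m (w x : {'GL_m[F]}) (om : 'S_m.-1.+1) a b :
  GLval w = perm_mx om -> GLval (w * x * w^-1)%g a b = GLval x (om a) (om b).
Proof.
move=> defw; rewrite !GL_MxE GL_VxE defw.
have -> : invmx (perm_mx om) = perm_mx om^-1 :> 'M[F]_m.-1.+1.
  apply: (mulrI (@unitmx_perm F _ om)); rewrite mulrV ?unitmx_perm //.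
  by rewrite -[RHS]/(perm_mx om *m perm_mx om^-1) -perm_mxM mulgV perm_mx1.
by rewrite -row_permE -col_permE !mxE.
Qed.

(** Schur orthogonality between representations of groups GL_r and GL_r' whose
    bases are matched by a bijection p: its existence forces r = r', and h is then
    the conjugation by the permutation matrix of p, which does not change the
    isomorphism class. *)
Lemma schur_twist (C : numClosedFieldType) (F : finFieldType) (r r' d d' : nat)
    (tau : mx_representation C 'GL_r[F] d) (tau' : mx_representation C 'GL_r'[F] d')
    (p : 'I_r'.-1.+1 -> 'I_r.-1.+1) (h : {'GL_r'[F]} -> {'GL_r[F]}) a b x y :
  (0 < r)%N -> (0 < r')%N -> bijective p ->
  (forall u c c', GLval (h u) (p c) (p c') = GLval u c c') ->
  mx_irreducible tau -> mx_irreducible tau' -> ~ GL_rsim tau tau' ->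
  \sum_(u : {'GL_r'[F]}) tau (h u) a b * tau' u^-1%g x y = 0.
Proof.
move=> r0 r0' bij_p hE irr irr' nsim.
have e : r = r'.
  have := bij_eq_card bij_p; rewrite !card_ord !prednK //.
subst r'; have {nsim} ns : ~ mx_rsim tau tau' by move=> sim; apply: nsim; exists erefl.
have inj_p := bij_inj bij_p; pose w := perm inj_p.
have [P defP] := GL_exists (@unitmx_perm F _ w).
have hP u : h u = (P^-1 * u * P)%g.
  apply: (mulgI P); rewrite !mulgA mulgV mul1g; apply: (mulIg P^-1%g); rewrite mulgK.
  apply: val_inj; apply/matrixP => i j.
  by rewrite -[LHS]/(GLval (P * h u * P^-1)%g i j) (GL_conj_perm _ _ _ defP) !permE hE.
have := @schur_avg_neq C _ _ _ _ tau tau' (tau P *m delta_mx b x) irr irr' ns.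
move/(congr1 (fun M => (tau P^-1%g *m M) a y)); rewrite mulmx0 [RHS]mxE => E0; apply: etrans E0.
rewrite mulmx_sumr summxE; apply: eq_big => [u|u _]; first by rewrite !inE.
rewrite hP !mulmxA -!repr_mxM ?inE ?mulgA //.
by rewrite mulmx_delta_entry.
Qed.

(** * Induced representations *)

Section Induced.
Variables (C : fieldType) (gT : finGroupType) (G P : {group gT}) (d : nat).
Variable rP : mx_representation C P d.
Hypothesis sPG : P \subset G.

Local Notation t := (@coset_rep gT G P).
Local Notation ext := (ext0 rP).

(** The map v |-> v (x) 1 into the induced module. *)
Definition ind_unit : 'M[C]_(d, ind_dim G P d) := \mxrow_j ext (t j)^-1%g.
(** The component at the trivial coset, i.e. the evaluation at 1 when the induced
    module is seen as a space of functions on G. *)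
Definition ind_eval : 'M[C]_(ind_dim G P d, d) := \mxcol_j ext (t j).

Lemma coset_rep_exists x : x \in G -> exists j, (x * (t j)^-1)%g \in P.
Proof.
move=> Gx; have Px : P :* x \in rcosets P G by apply/rcosetsP; exists x.
exists (enum_rank_in Px (P :* x)); rewrite /coset_rep enum_rankK_in //.
have /rcosetP[p Pp ->] := mem_repr_rcoset P x.
by rewrite invMg mulKVg groupV.
Qed.

Lemma coset_rep_mem j : t j \in G.
Proof.
rewrite /coset_rep; have /rcosetsP[y Gy ->] := enum_valP j.
by have /rcosetP[p Pp ->] := mem_repr_rcoset P y; rewrite groupM // (subsetP sPG).
Qed.

(** Only the coset of x contributes.  This is the composition rule of block
    matrices indexed by cosets. *)
Lemma sum_ext0 x y : x \in G ->
  \sum_j ext (x * (t j)^-1)%g *m ext (t j * y)%g = ext (x * y)%g.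
Proof.
move=> Gx; have [j Pj] := coset_rep_exists Gx.
rewrite (bigD1 j) //= big1 ?addr0 => [|k ne_kj].
  rewrite {1}/ext0 Pj -ext0M // mulgA.
  by rewrite mulgKV.
rewrite {1}/ext0; case: ifP => Pk; rewrite ?mul0mx //.
case/eqP: ne_kj; apply: (@coset_rep_inj _ G P).
have := groupM (groupVr Pk) Pj; rewrite invMg invgK.
by rewrite !mulgA mulgKV.
Qed.

Lemma ind_unit_mul g : g \in G ->
  ind_unit *m ind_mx G rP g = \mxrow_j ext (g * (t j)^-1)%g.
Proof.
move=> Gg; rewrite /ind_unit /ind_mx mul_mxrow_mxblock; apply/eq_mxrow => k.
rewrite -[in RHS](mul1g g) -[in RHS]mulgA -(sum_ext0 (g * (t k)^-1) (group1 G)).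
by apply: eq_bigr => j _; rewrite mul1g !mulgA.
Qed.

Lemma ind_eval_mul g : g \in G ->
  ind_mx G rP g *m ind_eval = \mxcol_i ext (t i * g)%g.
Proof.
move=> Gg; rewrite /ind_eval /ind_mx mul_mxblock_mxrow; apply/eq_mxcol => k.
have Gk := coset_rep_mem k.
rewrite -[in RHS](mulg1 (t k * g)%g) -(sum_ext0 1%g) ?groupM //.
by apply: eq_bigr => j _; rewrite mulg1.
Qed.

Lemma ind_unit_eval g : g \in G -> ind_unit *m ind_mx G rP g *m ind_eval = ext g.
Proof.
move=> Gg; rewrite ind_unit_mul // mul_mxrow_mxcol.
rewrite -[in RHS](mulg1 g) -(sum_ext0 1%g) //.
by apply: eq_bigr => j _; rewrite mulg1.
Qed.

Lemma ind_unitP p : p \in P -> ind_unit *m ind_mx G rP p = rP p *m ind_unit.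
Proof.
move=> Pp; rewrite ind_unit_mul ?(subsetP sPG) // mul_mxrow.
by apply/eq_mxrow => j; rewrite ext0M.
Qed.

Lemma ind_evalP p : p \in P -> ind_mx G rP p *m ind_eval = ind_eval *m rP p.
Proof.
move=> Pp; rewrite ind_eval_mul ?(subsetP sPG) // mxcol_mul.
apply/eq_mxcol => j; rewrite /ext0 groupMr //; case: ifP => Pj; rewrite ?mul0mx //.
by rewrite repr_mxM.
Qed.

Lemma ind_unit_gen m (M : 'M_(_, m)) :
  (forall g, g \in G -> ind_unit *m ind_mx G rP g *m M = 0) -> M = 0.
Proof.
move=> h; rewrite -[M]submxcolK -mxcol0; apply/eq_mxcol => j.
have := h _ (coset_rep_mem j); rewrite ind_unit_mul ?coset_rep_mem //.
rewrite -{1}[M]submxcolK mul_mxrow_mxcol (bigD1 j) //= big1 ?addr0.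
  by rewrite mulgV /ext0 group1 repr_mx1 mul1mx => <-.
move=> k ne; rewrite /ext0; case: ifP => [/coset_rep_inj eq|_]; last by rewrite mul0mx.
by rewrite eq eqxx in ne.
Qed.

Lemma ind_eval_cogen m (M : 'M_(m, _)) :
  (forall g, g \in G -> M *m ind_mx G rP g *m ind_eval = 0) -> M = 0.
Proof.
move=> h; rewrite -[M]submxrowK -mxrow0; apply/eq_mxrow => j.
have := h _ (groupVr (coset_rep_mem j)).
rewrite -mulmxA ind_eval_mul ?groupV ?coset_rep_mem //.
rewrite -{1}[M]submxrowK mul_mxrow_mxcol (bigD1 j) //= big1 ?addr0.
  by rewrite mulgV /ext0 group1 repr_mx1 mulmx1 => <-.
move=> k ne; rewrite /ext0; case: ifP => [/coset_rep_inj eq|_]; last by rewrite mulmx0.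
by rewrite eq eqxx in ne.
Qed.

Lemma ind_tensE v g : g \in G -> ind_tens G rP v g = v *m ind_unit *m ind_mx G rP g.
Proof.
by move=> Gg; rewrite -mulmxA ind_unit_mul // mul_mxrow.
Qed.

End Induced.

(** * Intertwiners between cuspidal data *)

Section TwoLevel.
Variables (F : finFieldType) (N t : nat) (n r : 'I_t -> nat).
Hypotheses (n0 : forall i, (0 < n i)%N) (r0 : forall i, (0 < r i)%N).
Hypotheses (N0 : (0 < N)%N) (eN : (\sum_i n i * r i = N)%N).

Local Notation s := (fun i => n i * r i)%N.
Local Notation s2 i := (fun _ : 'I_(n i) => r i).

Let s0 i : (0 < s i)%N. Proof. by rewrite muln_gt0 n0 r0. Qed.
Let es2 i : (\sum_k s2 i k = n i * r i)%N.
Proof. by rewrite sum_nat_const card_ord. Qed.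
Let r0' i (k : 'I_(n i)) : (0 < s2 i k)%N. Proof. exact: r0. Qed.

Definition fine_block : finType := {i : 'I_t & 'I_(n i)}.

Definition mk_fine i (k : 'I_(n i)) : fine_block := Tagged (fun i => 'I_(n i)) k.

Definition fine_pos i (k : 'I_(n i)) (c : 'I_(r i).-1.+1) : 'I_N.-1.+1 :=
  block_pos N s i (block_pos (n i * r i) (s2 i) k c).

Lemma fine_pos_surj x : exists i k c, x = @fine_pos i k c.
Proof.
have [i [a ->]] := block_pos_surj eN N0 s0 x.
have [k [c ->]] := block_pos_surj (es2 i) (s0 i) (@r0' i) a.
by exists i, k, c.
Qed.

Lemma fine_pos_block i (a : 'I_(s i).-1.+1) : exists k c, block_pos N s i a = @fine_pos i k c.
Proof.
by have [k [c ->]] := block_pos_surj (es2 i) (s0 i) (@r0' i) a; exists k, c.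
Qed.

Lemma fine_pos_eq i k c i' k' c' :
  (@fine_pos i k c == @fine_pos i' k' c') = [&& i == i', k == k' :> nat & c == c' :> nat].
Proof.
rewrite /fine_pos block_pos_eq //; case: (eqVneq i i') => //= e.
case: _ / e k' c' => k' c'.
by rewrite val_eqE (block_pos_eq (es2 i)) //; exact: r0'.
Qed.

Lemma fine_pos_inj i k : injective (@fine_pos i k).
Proof. by move=> c c' /eqP; rewrite fine_pos_eq !eqxx => /eqP/val_inj. Qed.

Definition fine_of_proof x : exists p : fine_block, [exists c, @fine_pos (tag p) (tagged p) c == x].
Proof.
have [i [k [c ->]]] := fine_pos_surj x.
by exists (mk_fine k); apply/existsP; exists c.
Qed.

(** The block of GL_(r i) that contains the position x. *)
Definition fine_of x : fine_block := xchoose (fine_of_proof x).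

Lemma fine_of_pos i k c : fine_of (@fine_pos i k c) = mk_fine k.
Proof.
have := xchooseP (fine_of_proof (@fine_pos i k c)); rewrite -/(fine_of _).
case: (fine_of _) => j l /= /existsP[c']; rewrite fine_pos_eq => /and3P[/eqP e].
by case: _ / e k c => k c /eqP/val_inj->.
Qed.

(** The first position of the block of x: a number, so that blocks are compared by
    comparing numbers. *)
Definition fine_start x : nat := @fine_pos (tag (fine_of x)) (tagged (fine_of x)) ord0.

Lemma fine_start_pos i k c : fine_start (@fine_pos i k c) = @fine_pos i k ord0.
Proof. by rewrite /fine_start fine_of_pos. Qed.

Lemma fine_ofP i k x : reflect (exists c, x = @fine_pos i k c) (fine_of x == mk_fine k).
Proof.
apply: (iffP eqP) => [|[c ->]]; last exact: fine_of_pos.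
have [j [l [c ->]]] := fine_pos_surj x; rewrite fine_of_pos => e.
have ej : j = i := congr1 (@tag _ _) e; case: _ / ej k e => k.
by move/eqP; rewrite eq_Tagged /= => /eqP<-; exists c.
Qed.

Lemma fine_start_eq x y : (fine_start x == fine_start y) = (fine_of x == fine_of y).
Proof.
rewrite /fine_start val_eqE fine_pos_eq eqxx andbT; case: (fine_of x) (fine_of y) => [i k] [j l] /=.
rewrite -tag_eqE /tag_eq /=; case: (eqVneq i j) => //= e.
by case: _ / e l => l; rewrite tagged_asE val_eqE.
Qed.

Lemma fine_start_lt_coarse (i j : 'I_t) k l c c' : (i < j)%N ->
  (fine_start (@fine_pos i k c) < fine_start (@fine_pos j l c'))%N.
Proof. by move=> lt; rewrite !fine_start_pos; apply: block_pos_lt. Qed.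

Lemma fine_start_lt_fine i (k l : 'I_(n i)) c c' : (k < l)%N ->
  (fine_start (@fine_pos i k c) < fine_start (@fine_pos i l c'))%N.
Proof.
move=> lt; rewrite !fine_start_pos /fine_pos block_pos_ltE //.
by rewrite (block_pos_lt (es2 i)) //; exact: r0'.
Qed.

Lemma fine_start_le (x y : 'I_N.-1.+1) : (x <= y)%N -> (fine_start x <= fine_start y)%N.
Proof.
rewrite leqNgt => /negP nlt; rewrite leqNgt; apply/negP => lt; apply: nlt.
have [i [k [c defx]]] := fine_pos_surj x; have [j [l [c' defy]]] := fine_pos_surj y.
case: (ltngtP i j) => [ltij|ltji|eij].
- by move: lt; rewrite defx defy ltnNge (ltnW (fine_start_lt_coarse _ _ _ _ ltij)).
- by rewrite defx defy; apply: block_pos_lt.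
have {}eij : i = j by exact: val_inj.
case: _ / eij l c' defy => l c' defy.
case: (ltngtP k l) => [ltkl|ltlk|ekl].
- by move: lt; rewrite defx defy ltnNge (ltnW (fine_start_lt_fine _ _ ltkl)).
- by rewrite defx defy block_pos_ltE // (block_pos_lt (es2 i)) //; exact: r0'.
by move: lt; rewrite defx defy !fine_start_pos (val_inj ekl) ltnn.
Qed.

(** Membership in the block upper triangular parabolic subgroup Q with [n i] blocks
    of size [r i] for each i. *)
Definition fine_parabolic (g : {'GL_N[F]}) :=
  forall x y, GLval g x y != 0 -> (fine_start x <= fine_start y)%N.

Lemma fine_parabolic_sub g : fine_parabolic g -> g \in parabolic F N s.
Proof.
move=> Qg; apply/(parabolicE eN N0 s0) => i j a b ltji.
have [k [c ->]] := block_pos_surj (es2 i) (s0 i) (@r0' i) a.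
have [l [c' ->]] := block_pos_surj (es2 j) (s0 j) (@r0' j) b.
apply/eqP; apply/negPn/negP => /Qg; rewrite leqNgt => /negP[].
exact: fine_start_lt_coarse.
Qed.

Lemma fine_parabolic_levi g i : fine_parabolic g ->
  levi_part s g i \in parabolic F (n i * r i) (s2 i).
Proof.
move=> Qg; apply/(parabolicE (es2 i) (s0 i) (@r0' i)) => k l a b ltlk.
rewrite (levi_partE eN N0 s0) ?fine_parabolic_sub //.
apply/eqP; apply/negPn/negP => /Qg; rewrite leqNgt => /negP[].
exact: fine_start_lt_fine.
Qed.

Definition fine_levi (g : {'GL_N[F]}) i (k : 'I_(n i)) : {'GL_(r i)[F]} :=
  levi_part (s2 i) (levi_part s g i) k.

Lemma fine_leviE g i k c c' : fine_parabolic g ->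
  GLval (@fine_levi g i k) c c' = GLval g (fine_pos k c) (fine_pos k c').
Proof.
move=> Qg; rewrite /fine_levi (levi_partE (es2 i) (s0 i) (@r0' i)) ?fine_parabolic_levi //.
by rewrite (levi_partE eN N0 s0) ?fine_parabolic_sub.
Qed.

Lemma fine_parabolic_upper (g : {'GL_N[F]}) : upper (GLval g) -> fine_parabolic g.
Proof.
by move=> ug x y nz; apply: fine_start_le; rewrite leqNgt; apply: contra nz => /ug->.
Qed.

(** The elements of GL_(r i), embedded as the k-th block of the i-th Levi factor. *)
Lemma block_exists i k (u : {'GL_(r i)[F]}) : exists g : {'GL_N[F]},
  [/\ fine_parabolic g, fine_levi g k = u &
      forall x y, (fine_of x != mk_fine k) || (fine_of y != mk_fine k) ->
         GLval g x y = (x == y)%:R].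
Proof.
pose u2 := dfwith (fun l : 'I_(n i) => 1%g : {'GL_(s2 i l)[F]}) (i := k) u.
have [h [Ph h1 h2 h3]] := diagGL_exists (es2 i) (s0 i) (@r0' i) u2.
pose u1 := dfwith (fun j : 'I_t => 1%g : {'GL_(s j)[F]}) (i := i) h.
have [g [Pg g1 g2 g3]] := diagGL_exists eN N0 s0 u1.
have E x y : (fine_of x != mk_fine k) || (fine_of y != mk_fine k) -> GLval g x y = (x == y)%:R.
  have [i1 [k1 [c1 ->]]] := fine_pos_surj x; have [i2 [k2 [c2 ->]]] := fine_pos_surj y.
  rewrite !fine_of_pos; case: (eqVneq i1 i2) => [e|ne]; last first.
    by rewrite g3 // fine_pos_eq (negPf ne).
  case: _ / e k2 c2 => k2 c2 {y}; rewrite g2 fine_pos_eq eqxx /=.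
  case: (eqVneq i i1) => [e|ne _]; last first.
    rewrite /u1 dfwith_out // GL_1E mxE -val_eqE.
    by rewrite val_eqE (block_pos_eq (es2 i1) (s0 i1) (@r0' i1)).
  case: _ / e k1 c1 k2 c2 => k1 c1 k2 c2; rewrite /u1 dfwith_in !eq_Tagged /=.
  case: (eqVneq k1 k2) => [<-|ne _]; last by rewrite h3 // val_eqE (negPf ne).
  rewrite orbb h2 eqxx /= val_eqE => ne.
  by rewrite /u2 dfwith_out ?GL_1E ?mxE // eq_sym.
have Qg : fine_parabolic g.
  move=> x y; case: (boolP ((fine_of x != mk_fine k) || (fine_of y != mk_fine k))) => [ne|].
    by rewrite (E _ _ ne); case: (eqVneq x y) => [->|]; rewrite ?eqxx.
  by rewrite negb_or !negbK => /andP[/eqP ex /eqP ey] _; rewrite leq_eqVlt fine_start_eq ex ey eqxx.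
exists g; split=> //.
by rewrite /fine_levi g1 /u1 dfwith_in h1 /u2 dfwith_in.
Qed.

Lemma fine_parabolic_unip (g : {'GL_N[F]}) :
  (forall x, GLval g x x = 1) ->
  (forall x y, x != y -> GLval g x y != 0 -> (fine_start x < fine_start y)%N) ->
  fine_parabolic g /\ forall i k, @fine_levi g i k = 1%g.
Proof.
move=> g1 g2; have Qg : fine_parabolic g.
  move=> x y nz; case: (eqVneq x y) => [->//|ne]; exact/ltnW/g2.
split=> // i k; apply: val_inj; apply/matrixP => c c'.
rewrite [LHS]fine_leviE // [RHS]mxE.
case: (eqVneq c c') => [->//|ne].
apply/eqP/negPn/negP => nz.
have := g2 _ _ _ nz; rewrite !fine_start_pos ltnn (inj_eq (@fine_pos_inj i k)).
by move=> /(_ ne).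
Qed.

Variables (C : numClosedFieldType) (d : 'I_t -> nat).
Variable tau : forall i, mx_representation C 'GL_(r i)[F] (d i).

(** The action of Q on the tensor product of all the cuspidal representations. *)
Definition cusp_levi_mx (g : {'GL_N[F]}) :
    'M[C]_(tens_dim (fun i => tens_dim (fun _ : 'I_(n i) => d i))) :=
  tens_mx (fun i => tens_mx (fun k : 'I_(n i) => tau i (fine_levi g k))).

Definition fine_slot i (k : 'I_(n i)) (A : 'M[C]_(d i)) :
    'M[C]_(tens_dim (fun i => tens_dim (fun _ : 'I_(n i) => d i))) :=
  @slot C t (fun i => tens_dim (fun _ : 'I_(n i) => d i)) i
    (@slot C (n i) (fun _ => d i) k A).

Lemma fine_slot_entry i k a b : exists c x y, forall A, @fine_slot i k A a b = c * A x y.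
Proof.
have [c hc] := @slot_entry C t (fun i => tens_dim (fun _ : 'I_(n i) => d i)) i a b.
have [c' hc'] := @slot_entry C (n i) (fun _ => d i) k (tens_ix a i) (tens_ix b i).
exists (c * c'); exists (tens_ix (tens_ix a i) k), (tens_ix (tens_ix b i) k) => A.
by rewrite /fine_slot hc hc' mulrA.
Qed.

Lemma fine_slot_sum0 i k (I : finType) (P : pred I) (A : I -> 'M_(d i)) :
  \sum_(u | P u) A u = 0 -> \sum_(u | P u) @fine_slot i k (A u) = 0.
Proof.
move=> sA; apply/matrixP => a b; rewrite summxE [RHS]mxE.
have [c [x [y E]]] := @fine_slot_entry i k a b.
under eq_bigr do rewrite E.
by rewrite -mulr_sumr -summxE sA mxE mulr0.
Qed.

Lemma fine_slot_schur i k j l (I : finType) (A : I -> 'M_(d i)) (B : I -> 'M_(d j)) M :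
  (forall x y z w, \sum_u A u x y * B u z w = 0) ->
  \sum_u @fine_slot i k (A u) *m M *m @fine_slot j l (B u) = 0.
Proof.
move=> sAB; apply/matrixP => a b; rewrite summxE [RHS]mxE.
under eq_bigr => u _ do rewrite mxE.
rewrite exchange_big big1 //= => b' _.
under eq_bigr => u _ do rewrite mxE mulr_suml.
rewrite exchange_big big1 //= => a' _.
have [c [x [y E]]] := @fine_slot_entry i k a a'.
have [c' [z [w E']]] := @fine_slot_entry j l b' b.
under eq_bigr => u _.
  rewrite E E' (_ : _ * _ * _ = (c * M a' b' * c') * (A u x y * B u z w)); last by ring.
  over.
by rewrite -mulr_sumr sAB mulr0.
Qed.

Lemma fine_slotM i k A B : @fine_slot i k A *m fine_slot k B = fine_slot k (A *m B).
Proof. by rewrite /fine_slot !slotM. Qed.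

Lemma fine_slot_1 i k : @fine_slot i k 1%:M = 1%:M.
Proof. by rewrite /fine_slot !slot1. Qed.

Lemma cusp_levi_mx_unip g : (forall i k, @fine_levi g i k = 1%g) -> cusp_levi_mx g = 1%:M.
Proof.
move=> g1; rewrite /cusp_levi_mx -tens_mx1; apply: eq_tens_mx => i.
by rewrite -tens_mx1; apply: eq_tens_mx => k; rewrite g1 repr_mx1.
Qed.

Lemma cusp_levi_mx_block g i k :
  (forall j l, @mk_fine j l != @mk_fine i k -> fine_levi g l = 1%g) ->
  cusp_levi_mx g = fine_slot k (tau i (fine_levi g k)).
Proof.
move=> g1; rewrite /cusp_levi_mx /fine_slot /slot; apply: eq_tens_mx => j.
case: (eqVneq i j) => [e|ne]; last first.
  rewrite dfwith_out // -tens_mx1; apply: eq_tens_mx => l.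
  by rewrite g1 ?repr_mx1 // -tag_eqE /tag_eq /= eq_sym (negPf ne).
case: _ / e; rewrite dfwith_in; apply: eq_tens_mx => l.
case: (eqVneq k l) => [<-|ne]; first by rewrite dfwith_in.
by rewrite dfwith_out // g1 ?repr_mx1 // eq_Tagged eq_sym.
Qed.

Hypothesis irr_tau : forall i, mx_irreducible (tau i).
Hypothesis cusp_tau : forall i, cuspidal (tau i).

Variable psi : {'GL_N[F]} -> 'M[C]_(tens_dim (fun i => tens_dim (fun _ : 'I_(n i) => d i))).
Hypothesis psiM : forall q g q', fine_parabolic q -> fine_parabolic q' ->
  psi (q * g * q')%g = cusp_levi_mx q *m psi g *m cusp_levi_mx q'.

Lemma fine_parabolic1 : fine_parabolic 1%g.
Proof. by move=> x y; rewrite GL_1E mxE; case: (eqVneq x y) => [->|]; rewrite ?eqxx. Qed.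

Lemma cusp_levi_mx1 : cusp_levi_mx 1%g = 1%:M.
Proof. by apply: cusp_levi_mx_unip => i k; rewrite /fine_levi !levi_part1. Qed.

Lemma exists_perm_prefix m (S : {set 'I_m}) :
  exists p : 'S_m, forall c, (p c \in S) = (c < #|S|)%N.
Proof.
pose e := enum S ++ enum (~: S).
have se : size e = m.
  by rewrite size_cat -!cardE cardsC card_ord.
have ue : uniq e.
  rewrite cat_uniq !enum_uniq andbT /=; apply/hasPn => x.
  by rewrite !mem_enum inE.
pose f c := nth c e c.
have finj : injective f.
  move=> c c' /eqP; rewrite /f (set_nth_default c) ?se //.
  by rewrite nth_uniq ?se // => /eqP/val_inj.
exists (perm finj) => c; rewrite permE /f nth_cat -cardE.
case: ltnP => h; first by rewrite -mem_enum mem_nth -?cardE.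
have : nth c (enum (~: S)) (c - #|S|)%N \in enum (~: S).
  rewrite mem_nth // -cardE; have := ltn_ord c; rewrite -{2}se size_cat -!cardE.
  by rewrite -{1}(subnKC h) ltn_add2l.
by rewrite mem_enum inE => /negPf.
Qed.

(** Let S be the set of the positions of the block that w^-1 sends to the first
    fine blocks, up to that of c0; by hypothesis S is not the whole block.  The
    elements of GL_(r i) that differ from 1 only at entries with row in S and
    column outside S form the unipotent radical of a two-block parabolic, up to a
    permutation of the basis.  Conjugation by w makes them strictly block upper
    triangular, so that they act trivially on the left of psi(w).  Hence they fix
    psi(w) on the right, while the sum of their matrices is 0 by cuspidality. *)
Lemma kernel_split_block0 w (om : 'S_N.-1.+1) i k c0 c1 : GLval w = perm_mx om ->
  (fine_start (om^-1%g (@fine_pos i k c0)) < fine_start (om^-1%g (@fine_pos i k c1)))%N ->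
  psi w = 0.
Proof.
move=> defw lt01.
pose S := [set c |
  (fine_start (om^-1%g (@fine_pos i k c)) <= fine_start (om^-1%g (@fine_pos i k c0)))%N].
have [p pS] := exists_perm_prefix S.
pose sz (j : 'I_2) := if j == 0 then #|S| else (r i - #|S|)%N.
have Sle : (#|S| < r i)%N.
  rewrite -[X in (_ < X)%N](prednK (r0 i)) -[X in (_ < X)%N]card_ord.
  rewrite -cardsT proper_card // properT; apply/eqP => ST.
  by have := in_setT c1; rewrite -ST inE leqNgt lt01.
have S0 : (0 < #|S|)%N by apply/card_gt0P; exists c0; rewrite inE.
have sz_gt0 j : (0 < sz j)%N by rewrite /sz; case: eqP; rewrite ?subn_gt0.
have sz_sum : (\sum_j sz j = r i)%N.
  by rewrite big_ord_recl big_ord1 /sz /= subnKC // ltnW.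
have sum0 := sum_unipotent0 sz_sum (r0 i) sz_gt0 (cusp_tau (ltnSn 1) sz_gt0 sz_sum).
have [P defP] := GL_exists (@unitmx_perm F _ p^-1%g).
pose y (u : {'GL_(r i)[F]}) := (P * u * P^-1)%g.
have yE u a b : GLval (y u) a b = GLval u (p^-1%g a) (p^-1%g b).
  exact: GL_conj_perm.
(* Cuspidality, transported by the permutation that sorts S to the front. *)
have sum_y : \sum_(u in unipotent F (r i) sz) tau i (y u) = 0.
  transitivity (tau i P *m (\sum_(u in unipotent F (r i) sz) tau i u) *m tau i P^-1%g).
    rewrite mulmx_sumr mulmx_suml; apply: eq_bigr => u _.
    by rewrite -!repr_mxM ?inE.
  by rewrite sum0 mulmx0 mul0mx.
have yS u a b : u \in unipotent F (r i) sz -> GLval (y u) a b != (a == b)%:R ->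
    (a \in S) && (b \notin S).
  move=> /(unipotentE sz_sum (r0 i) sz_gt0)[/(parabolicE sz_sum (r0 i) sz_gt0) Pu Du].
  rewrite yE -(permKV p a) -(permKV p b) !permK !pS (inj_eq perm_inj).
  move: (p^-1%g a) (p^-1%g b) => {}a {}b.
  have [j1 [e1 ->]] := block_pos_surj sz_sum (r0 i) sz_gt0 a.
  have [j2 [e2 ->]] := block_pos_surj sz_sum (r0 i) sz_gt0 b.
  case: (eqVneq j1 j2) => [e|ne12].
    by case: _ / e e2 => e2; rewrite Du (inj_eq (@block_pos_inj _ _ _ sz_sum (r0 i) sz_gt0 _)) ?eqxx.
  rewrite block_pos_eq // (negPf ne12) /=.
  case: (ltnP j2 j1) => [lt|]; first by rewrite Pu // eqxx.
  rewrite leq_eqVlt val_eqE (negPf ne12) /= => lt _.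
  have j10 : j1 = 0.
    by apply: val_inj => /=; move: lt (ltn_ord j2); case: (j1 : nat) (j2 : nat) => [|?] [|[|?]].
  have j21 : (j2 == 0) = false.
    by rewrite -val_eqE; apply/negbTE; rewrite -lt0n (leq_ltn_trans _ lt).
  have szj : sz j1 = #|S| by rewrite j10.
  have h1 : (e1 < #|S|)%N by apply: leq_trans (ltn_ord e1) _; rewrite szj prednK.
  rewrite -leqNgt !(block_pos_val sz_sum (r0 i) sz_gt0) big1 => [|j]; last by rewrite j10 ltn0.
  rewrite add0n h1 (bigD1 0) /=; last by rewrite lt0n; exact: negbT j21.
  by rewrite -addnA leq_addr.
(* psi(w) is fixed by the block element x attached to u. *)
have step u : u \in unipotent F (r i) sz -> psi w = psi w *m fine_slot k (tau i (y u)).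
  move=> Uu; have [x [Qx lx xE]] := block_exists k (y u).
  have xk c c' : GLval x (fine_pos k c) (fine_pos k c') = GLval (y u) c c'.
    by rewrite -(fine_leviE k c c' Qx) lx.
  have xE2 a b : GLval x a b != (a == b)%:R ->
      exists c c', [/\ a = fine_pos k c, b = fine_pos k c', c \in S & c' \notin S].
    case: (boolP ((fine_of a != mk_fine k) || (fine_of b != mk_fine k))) => [/xE->|].
      by rewrite eqxx.
    rewrite negb_or !negbK => /andP[/fine_ofP[c ->] /fine_ofP[c' ->]].
    rewrite xk (inj_eq (@fine_pos_inj i k)) => /(yS _ _ _ Uu)/andP[Sc Sc'].
    by exists c, c'.
  have [Qq q1] : fine_parabolic (w * x * w^-1)%g /\
      forall j l, @fine_levi (w * x * w^-1)%g j l = 1%g.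
    apply: fine_parabolic_unip => [a|a b ne].
      rewrite (GL_conj_perm _ _ _ defw); apply/eqP/negPn/negP => ne1.
      have [|c [c' [ea eb Sc Sc']]] := xE2 (om a) (om a); first by rewrite eqxx.
      by move: Sc'; rewrite -(fine_pos_inj (etrans (esym ea) eb)) Sc.
    rewrite (GL_conj_perm _ _ _ defw) => nz.
    have [|c [c' [ea eb Sc Sc']]] := xE2 (om a) (om b).
      by rewrite (inj_eq perm_inj) (negPf ne).
    rewrite -[a](permK om) -[b](permK om) ea eb.
    by apply: leq_ltn_trans (_ : _ <= _)%N _;
      [move: Sc; rewrite inE; apply | move: Sc'; rewrite inE -ltnNge].
  have e1 : psi (w * x)%g = psi w *m cusp_levi_mx x.
    rewrite -[(w * x)%g]mul1g mulgA psiM ?cusp_levi_mx1 ?mul1mx //.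
    exact: fine_parabolic1.
  have e2 : psi (w * x)%g = psi w.
    rewrite -[LHS]/(psi (w * x)%g) -(mulgKV w (w * x)%g) -[(_ * _ * w)%g]mulg1.
    by rewrite psiM ?cusp_levi_mx1 ?cusp_levi_mx_unip ?mul1mx ?mulmx1 //; exact: fine_parabolic1.
  rewrite -[LHS]e2 e1 (@cusp_levi_mx_block x i k) ?lx // => j l ne.
  apply: val_inj; apply/matrixP => c c'; rewrite [LHS]fine_leviE // [RHS]mxE.
  by rewrite xE ?fine_of_pos ?ne // (inj_eq (@fine_pos_inj _ _)).
have : (#|unipotent F (r i) sz|%:R : C) *: psi w = 0.
  rewrite scaler_nat -sumr_const.
  rewrite (eq_bigr _ step) -mulmx_sumr.
  by rewrite (fine_slot_sum0 k sum_y) mulmx0.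
move/eqP; rewrite scaler_eq0 pnatr_eq0 cards_eq0 => /orP[/eqP U0|/eqP//].
by have := unipotent1 sz_sum (r0 i) sz_gt0 F; rewrite U0 inE.
Qed.

Hypothesis nsim : forall i j, i != j -> ~ GL_rsim (tau i) (tau j).

(** If psi(w) is not 0 then w^-1 maps each fine block into a single one, and by
    counting it permutes the fine blocks.  If w is not in P, some block of type j
    goes to a block of type i with i different from j.  Then psi(w) intertwines
    tau_i and tau_j through this pair of blocks, and Schur orthogonality kills it. *)
Lemma kernel_perm0 w (om : 'S_N.-1.+1) : GLval w = perm_mx om ->
  w \notin parabolic F N s -> psi w = 0.
Proof.
move=> defw; apply: contraNeq => psi0; apply/(parabolicE eN N0 s0) => i j a b ltji.
rewrite defw !mxE.
case: (eqVneq (om (block_pos N s i a)) (block_pos N s j b)) => [omab|_]; last exact: mulr0n.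
case/eqP: psi0.
case: (boolP [exists i, exists k : 'I_(n i), exists c0, exists c1,
   (fine_start (om^-1%g (@fine_pos i k c0)) < fine_start (om^-1%g (@fine_pos i k c1)))%N]).
  by move=> /existsP[i1 /existsP[k1 /existsP[c0 /existsP[c1]]]]; exact: kernel_split_block0.
move=> nex; have stF i1 k1 c0 c1 :
    (fine_start (om^-1%g (@fine_pos i1 k1 c1)) <= fine_start (om^-1%g (@fine_pos i1 k1 c0)))%N.
  rewrite leqNgt; apply: contra nex => lt; apply/existsP; exists i1.
  by apply/existsP; exists k1; apply/existsP; exists c0; apply/existsP; exists c1.
have stE i1 k1 c0 c1 : fine_of (om^-1%g (@fine_pos i1 k1 c0)) = fine_of (om^-1%g (@fine_pos i1 k1 c1)).
  by apply/eqP; rewrite -fine_start_eq eqn_leq !stF.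
pose sg (p : fine_block) := fine_of (om^-1%g (@fine_pos (tag p) (tagged p) ord0)).
pose h (p : fine_block) := fine_of (om (@fine_pos (tag p) (tagged p) ord0)).
have sgK x : sg (fine_of (om x)) = fine_of x.
  have [i1 [k1 [c1 e]]] := fine_pos_surj (om x).
  by rewrite e fine_of_pos /sg /= (stE i1 k1 ord0 c1) -e permK.
(* sg and h are the maps that w^-1 and w induce on the fine blocks. *)
have hK : cancel h sg by move=> [i1 k1]; rewrite sgK fine_of_pos.
have sgK' := canF_sym hK.
have fine_of_om x y : fine_of x = fine_of y -> fine_of (om x) = fine_of (om y).
  by move=> e; apply: (can_inj sgK'); rewrite !sgK.
have [k [c defa]] := fine_pos_block a; have [k' [c' defb]] := fine_pos_block b.
have om_pt : om (fine_pos k c) = fine_pos k' c' by rewrite -defa -defb.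
have sgk' : sg (mk_fine k') = mk_fine k by rewrite -(fine_of_pos k' c') -om_pt sgK fine_of_pos.
have ex_p d0 : exists c0, om (fine_pos k c0) = fine_pos k' d0.
  have /fine_ofP[c0 e] : fine_of (om^-1%g (fine_pos k' d0)) == mk_fine k.
    by rewrite -sgk' /sg /= (stE _ _ d0 ord0).
  by exists c0; rewrite -e permKV.
have ex_p' c0 : exists d0, om (fine_pos k c0) = fine_pos k' d0.
  apply/fine_ofP; rewrite -(fine_of_pos k' c') -om_pt; apply/eqP/fine_of_om.
  by rewrite !fine_of_pos.
(* p is the matching, by w, of the positions inside the two blocks. *)
have [p pE] := fin_all_exists ex_p; have [p' pE'] := fin_all_exists ex_p'.
have bij_p : bijective p.
  exists p' => x; first by apply: (@fine_pos_inj j k'); rewrite -pE' pE.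
  by apply: (@fine_pos_inj i k); apply: (@perm_inj _ om); rewrite pE pE'.
have [X XE] := fin_all_exists (block_exists k').
pose q u := (w * X u * w^-1)%g.
have XE1 u x y : (fine_of x != mk_fine k') || (fine_of y != mk_fine k') ->
    GLval (X u) x y = (x == y)%:R.
  by case: (XE u) => _ _; apply.
have XE2 u c0 c1 : GLval (X u) (fine_pos k' c0) (fine_pos k' c1) = GLval u c0 c1.
  have [Qx lx _] := XE u; have e0 := fine_leviE k' c0 c1 Qx.
  by rewrite lx in e0; rewrite -e0.
have qE u x y : GLval (q u) x y = GLval (X u) (om x) (om y) by exact: GL_conj_perm.
have Qq u : fine_parabolic (q u).
  move=> x y; rewrite qE.
  case: (boolP ((fine_of (om x) != mk_fine k') || (fine_of (om y) != mk_fine k'))) => [ne|].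
    rewrite XE1 // (inj_eq perm_inj).
    by case: (eqVneq x y) => [->|]; rewrite ?eqxx.
  rewrite negb_or !negbK => /andP[/eqP ex /eqP ey] _.
  by rewrite leq_eqVlt fine_start_eq -(sgK x) -(sgK y) ex ey eqxx.
have T1 u : cusp_levi_mx (X u) = fine_slot k' (tau j u).
  have [Qx lx _] := XE u; rewrite (@cusp_levi_mx_block _ j k') ?lx // => j1 l ne.
  apply: val_inj; apply/matrixP => c0 c1; rewrite [LHS]fine_leviE // [RHS]mxE.
  by rewrite XE1 ?fine_of_pos ?ne // (inj_eq (@fine_pos_inj _ _)).
have T2 u : cusp_levi_mx (q u) = fine_slot k (tau i (fine_levi (q u) k)).
  apply: cusp_levi_mx_block => j1 l ne.
  apply: val_inj; apply/matrixP => c0 c1; rewrite [LHS]fine_leviE // [RHS]mxE.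
  rewrite qE XE1 ?(inj_eq perm_inj) ?(inj_eq (@fine_pos_inj _ _)) //.
  apply/orP; left; apply: contra ne => /eqP e.
  by rewrite -sgk' -e sgK fine_of_pos.
have comm u : psi w *m fine_slot k' (tau j u) = fine_slot k (tau i (fine_levi (q u) k)) *m psi w.
  have Qx : fine_parabolic (X u) by case: (XE u).
  have e1 : psi (w * X u)%g = psi w *m cusp_levi_mx (X u).
    by rewrite -[(w * X u)%g]mul1g mulgA psiM ?cusp_levi_mx1 ?mul1mx //; exact: fine_parabolic1.
  have e2 : psi (q u * w)%g = cusp_levi_mx (q u) *m psi w.
    by rewrite -[(q u * w)%g]mulg1 psiM ?cusp_levi_mx1 ?mulmx1 //; exact: fine_parabolic1.
  by rewrite -T1 -T2 -e1 -e2 /q mulgKV.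
have zero :
    \sum_u fine_slot k (tau i (fine_levi (q u) k)) *m psi w *m fine_slot k' (tau j u^-1%g) = 0.
  apply: (@fine_slot_schur i k j k' _ (fun u => tau i (fine_levi (q u) k)) (fun u => tau j u^-1%g)).
  move=> x y z v.
  apply: (@schur_twist _ _ _ _ _ _ (tau i) (tau j) p (fun u => fine_levi (q u) k)) => //.
    by move=> u c0 c1; rewrite fine_leviE // qE !pE XE2.
  by apply: nsim; apply: contraTneq ltji => ->; rewrite ltnn.
have : (#|{: {'GL_(r j)[F]}}|%:R : C) *: psi w = 0.
  rewrite -zero scaler_nat -sumr_const; apply: eq_bigr => u _.
  by rewrite -comm -mulmxA fine_slotM -repr_mxM ?inE // mulgV repr_mx1 fine_slot_1 mulmx1.
move/eqP; rewrite scaler_eq0 pnatr_eq0 => /orP[/eqP c0|/eqP//].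
by have := fintype0 (1%g : {'GL_(r j)[F]}) c0.
Qed.

Lemma kernel_off_parabolic g : g \notin parabolic F N s -> psi g = 0.
Proof.
move=> nPg; have [b [b' [om [ub ub' eg]]]] := bruhat (GL_unitmx g).
have := GL_unitmx g; rewrite [val g]eg !unitmx_mul -andbA => /and3P[Ub _ Ub'].
have [B eB] := GL_exists Ub; have [B' eB'] := GL_exists Ub'.
have [w ew] := GL_exists (@unitmx_perm F _ om).
have defg : g = (B * w * B')%g.
  by apply: val_inj; rewrite -[RHS]/(GLval (B * w * B')%g) !GL_MxE eB eB' ew.
have QB : fine_parabolic B by apply: fine_parabolic_upper; rewrite eB.
have QB' : fine_parabolic B' by apply: fine_parabolic_upper; rewrite eB'.
rewrite defg psiM // (kernel_perm0 ew) ?mulmx0 ?mul0mx //.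
apply: contra nPg => Pw; rewrite defg.
by apply: (groupM (G := parabolic_group F N s)); [apply: groupM => //|]; apply: fine_parabolic_sub.
Qed.

End TwoLevel.

(** * Tensor products of representations *)

(** A family of maps with no common annihilator has row spaces that span. *)
Lemma left_inverse_family (C : fieldType) (I : finType) m n (B : I -> 'M[C]_(m, n)) :
  (forall M : 'M_n, (forall g, B g *m M = 0) -> M = 0) ->
  exists K : I -> 'M_(n, m), \sum_g K g *m B g = 1%:M.
Proof.
move=> gen; pose S := (\sum_g <<B g>>)%MS.
have : (1%:M <= S)%MS.
  rewrite submxE; apply/eqP; rewrite mul1mx; apply: gen => g.
  apply/eqP; rewrite -submxE; apply: (submx_trans (B := <<B g>>%MS)).
    by rewrite genmxE.
  exact: (sumsmx_sup g).
case/sub_sumsmxP => u e1; exists (fun g => u g *m <<B g>>%MS *m pinvmx (B g)).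
rewrite e1; apply: eq_bigr => g _; rewrite mulmxKpV //.
by apply: submx_trans (submxMl _ _) _; rewrite genmxE.
Qed.

Lemma right_inverse_family (C : fieldType) (I : finType) m n (B : I -> 'M[C]_(m, n)) :
  (forall M : 'M_m, (forall g, M *m B g = 0) -> M = 0) ->
  exists K : I -> 'M_(n, m), \sum_g B g *m K g = 1%:M.
Proof.
move=> gen; have [|K eK] := @left_inverse_family C I n m (fun g => (B g)^T).
  move=> M h; apply: trmx_inj; rewrite trmx0; apply: gen => g.
  by apply: trmx_inj; rewrite trmx_mul trmxK h trmx0.
exists (fun g => (K g)^T); apply: trmx_inj; rewrite trmx1 -eK raddf_sum /=.
by apply: eq_bigr => g _; rewrite trmx_mul trmxK.
Qed.

Section TensGen.
Variables (C : fieldType) (t : nat) (J : 'I_t -> finType) (d e : 'I_t -> nat).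

Lemma rtens_gen (B : forall i, J i -> 'M[C]_(d i, e i)) m (M : 'M_(_, m)) :
  (forall i (M : 'M_(e i)), (forall g, B i g *m M = 0) -> M = 0) ->
  (forall u : forall i, J i, rtens (fun i => B i (u i)) *m M = 0) -> M = 0.
Proof.
move=> gen h; have [K eK] := fin_all_exists (fun i => left_inverse_family (gen i)).
rewrite -[M]mul1mx -rtens1 -(eq_rtens eK) -(@sum_rtens C t e e J (fun i g => K i g *m B i g)).
by rewrite mulmx_suml big1 // => u _; rewrite -rtensM -mulmxA h mulmx0.
Qed.

Lemma rtens_cogen (B : forall i, J i -> 'M[C]_(d i, e i)) m (M : 'M_(m, _)) :
  (forall i (M : 'M_(d i)), (forall g, M *m B i g = 0) -> M = 0) ->
  (forall u : forall i, J i, M *m rtens (fun i => B i (u i)) = 0) -> M = 0.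
Proof.
move=> gen h; have [K eK] := fin_all_exists (fun i => right_inverse_family (gen i)).
rewrite -[M]mulmx1 -rtens1 -(eq_rtens eK) -(@sum_rtens C t d d J (fun i g => B i g *m K i g)).
by rewrite mulmx_sumr big1 // => u _; rewrite -rtensM mulmxA h mul0mx.
Qed.
End TensGen.

Section TensSchur.
Variables (C : numClosedFieldType) (F : finFieldType) (t : nat) (s e e' : 'I_t -> nat).
Variable V : forall i, mx_representation C 'GL_(s i)[F] (e i).
Variable V' : forall i, mx_representation C 'GL_(s i)[F] (e' i).
Variable M : 'M[C]_(tens_dim e, tens_dim e').
Hypothesis hM : forall u : forall i, {'GL_(s i)[F]},
  tens_mx (fun i => V i (u i)) *m M = M *m tens_mx (fun i => V' i (u i)).

(** The average of M over the product of the groups is M itself, and its entries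
    are products of the averages of Schur orthogonality. *)
Lemma tens_avg a b :
  #|{: fprod (fun i => {'GL_(s i)[F]} : finType)}|%:R * M a b =
  \sum_a' \sum_b' M a' b' *
    \prod_i \sum_(g in 'GL_(s i)[F]) V i g (tens_ix a i) (tens_ix a' i) *
                                      V' i g^-1%g (tens_ix b' i) (tens_ix b i).
Proof.
pose J i : finType := {'GL_(s i)[F]}.
transitivity ((\sum_(u : fprod J) tens_mx (fun i => V i (u i)) *m M *m
                 tens_mx (fun i => V' i (u i)^-1%g)) a b).
  rewrite (eq_bigr (fun _ => M)) => [|u _].
    by rewrite sumr_const mulr_natl mulmxnE.
  rewrite hM -mulmxA tens_mxM.
  rewrite (eq_tens_mx (B := fun i => 1%:M)) ?tens_mx1 ?mulmx1 // => i.
  by rewrite -repr_mxM ?inE // mulgV repr_mx1.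
rewrite summxE.
transitivity (\sum_(u : fprod J) \sum_a' \sum_b' M a' b' *
   \prod_i (V i (u i) (tens_ix a i) (tens_ix a' i) * V' i (u i)^-1%g (tens_ix b' i) (tens_ix b i))).
  apply: eq_bigr => u _; rewrite mxE exchange_big; apply: eq_bigr => b' _.
  rewrite mxE mulr_suml; apply: eq_bigr => a' _.
  by rewrite !mxE big_split /=; ring.
rewrite exchange_big; apply: eq_bigr => a' _.
rewrite exchange_big; apply: eq_bigr => b' _.
rewrite -mulr_sumr; congr (_ * _).
rewrite -(@prod_sum_fprod C _ J (fun i g =>
  V i g (tens_ix a i) (tens_ix a' i) * V' i g^-1%g (tens_ix b' i) (tens_ix b i))).
by apply: eq_bigr => i _; apply: eq_bigl => g; rewrite inE.
Qed.

Lemma card_fprod_neq0 : #|{: fprod (fun i => {'GL_(s i)[F]} : finType)}|%:R != 0 :> C.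
Proof.
rewrite pnatr_eq0 -lt0n card_fprod; apply: prodn_gt0 => i.
by apply/card_gt0P; exists 1%g.
Qed.

Lemma tens_schur_neq i : (forall j, mx_irreducible (V j)) -> (forall j, mx_irreducible (V' j)) ->
  ~ mx_rsim (V i) (V' i) -> M = 0.
Proof.
move=> irr irr' ns; apply/matrixP => a b; rewrite [RHS]mxE.
apply: (mulfI card_fprod_neq0); rewrite tens_avg mulr0.
rewrite big1 // => a' _; rewrite big1 // => b' _.
by rewrite (bigD1 i) //= schur_orth_neq // mul0r mulr0.
Qed.

End TensSchur.

Lemma tens_schur_scalar (C : numClosedFieldType) (F : finFieldType) t (s e : 'I_t -> nat)
    (V : forall i, mx_representation C 'GL_(s i)[F] (e i)) M :
  (forall j, mx_irreducible (V j)) ->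
  (forall u : forall i, {'GL_(s i)[F]},
    tens_mx (fun i => V i (u i)) *m M = M *m tens_mx (fun i => V i (u i))) ->
  is_scalar_mx M.
Proof.
move=> irr hM.
pose c := #|{: fprod (fun i => {'GL_(s i)[F]} : finType)}|%:R^-1 *
   \sum_a' \sum_b' M a' b' *
     \prod_i (#|'GL_(s i)[F]|%:R / (e i)%:R * (tens_ix a' i == tens_ix b' i)%:R).
apply/is_scalar_mxP; exists c; apply/matrixP => a b.
apply: (mulfI (card_fprod_neq0 C F s)); rewrite (tens_avg hM) mxE.
rewrite -mulrnAr mulrA mulfV ?card_fprod_neq0 // mul1r -mulr_natr mulr_suml.
apply: eq_bigr => a' _; rewrite mulr_suml; apply: eq_bigr => b' _.
rewrite -mulrA; congr (_ * _).
under eq_bigr do rewrite schur_orth_eq //.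
have -> : (a == b)%:R = \prod_i (tens_ix a i == tens_ix b i)%:R :> C.
  have /matrixP/(_ a b) := @tens_mx1 C t e; rewrite !mxE => <-.
  by apply: eq_bigr => i _; rewrite mxE.
by rewrite -big_split; apply: eq_bigr => i _ /=; ring.
Qed.

(** * Harish-Chandra induction of representations with disjoint cuspidal support *)

Section Frobenius.
Variables (C : numClosedFieldType) (gT : finGroupType) (G P : {group gT}) (d e : nat).
Variables (rP : mx_representation C P d) (X : mx_representation C G e).
Hypothesis sPG : P \subset G.
Variable f : 'M[C]_(e, ind_dim G P d).
Hypothesis free_f : row_free f.
Hypothesis hom_f : forall g, g \in G -> X g *m f = f *m ind_mx G rP g.

(** Frobenius reciprocity for the inclusion f.  The second property says that pi
    sees every vector after translation by some group element. *)
Lemma frobenius_eval : exists pi : 'M_(e, d),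
  (forall p, p \in P -> X p *m pi = pi *m rP p) /\
  (forall m (M : 'M_(m, e)), (forall g, g \in G -> M *m X g *m pi = 0) -> M = 0).
Proof.
exists (f *m ind_eval G rP); split=> [p Pp|m M h].
  by rewrite mulmxA hom_f ?(subsetP sPG) // -mulmxA ind_evalP // mulmxA.
have [f' ff'] := row_freeP free_f.
rewrite -[M]mulmx1 -ff' mulmxA (_ : M *m f = 0) ?mul0mx //.
apply: (ind_eval_cogen sPG (rP := rP)) => g Gg.
by rewrite -(mulmxA M) -hom_f // mulmxA -(mulmxA _ f) h.
Qed.

(** Averaging a left inverse of f gives an equivariant map h back, with f h a nonzero
    scalar; iota is the restriction of h to the inducing representation. *)
Lemma frobenius_unit : exists iota : 'M_(d, e),
  (forall p, p \in P -> rP p *m iota = iota *m X p) /\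
  (forall m (M : 'M_(e, m)), (forall g, g \in G -> iota *m X g *m M = 0) -> M = 0).
Proof.
have [f' ff'] := row_freeP free_f.
pose h := \sum_(x in G) ind_repr G rP x *m f' *m X x^-1%g.
have hom_h g : g \in G -> ind_mx G rP g *m h = h *m X g.
  move=> Gg; exact: (@intertwiner_avg _ _ _ _ _ (ind_repr G rP) X f' g Gg).
have fh : f *m h = #|G|%:R%:M.
  rewrite mulmx_sumr (eq_bigr (fun _ => 1%:M)) => [|x Gx].
    by rewrite sumr_const -scaler_nat scalemx1.
  by rewrite !mulmxA -hom_f // -[_ *m f']mulmxA ff' mulmx1 -repr_mxM ?groupV // mulgV repr_mx1.
exists (ind_unit G rP *m h); split=> [p Pp|m M hM].
  by rewrite mulmxA -ind_unitP // -!mulmxA hom_h ?(subsetP sPG).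
have hM0 : h *m M = 0.
  apply: (ind_unit_gen sPG (rP := rP)) => g Gg.
  by rewrite mulmxA -(mulmxA _ _ h) hom_h // mulmxA hM.
have : f *m h *m M = 0 by rewrite -mulmxA hM0 mulmx0.
rewrite fh mul_scalar_mx => /eqP; rewrite scaler_eq0 pnatr_eq0.
by rewrite (gtn_eqF (cardG_gt0 G)) => /eqP.
Qed.

End Frobenius.

Lemma submod_hom (C : fieldType) (gT : finGroupType) (G : {group gT}) m e
    (R : mx_representation C G m) (X : mx_representation C G e) (M : 'M_m)
    (modM : mxmodule R M) :
  mx_rsim (submod_repr modM) X ->
  exists2 f : 'M_(e, m), row_free f & forall g, g \in G -> X g *m f = f *m R g.
Proof.
case/mx_rsim_sym=> B eM freeB hB; exists (val_submod B) => [|g Gg].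
  have [B' BB'] := row_freeP freeB.
  apply/row_freeP; exists (in_submod M 1%:M *m B').
  by rewrite mulmxA -in_submodE val_submodK.
by rewrite -val_submodJ // -hB // /val_submod /= mulmxA.
Qed.

Lemma mulmx_sandwich (R : pzSemiRingType) m1 m2 n1 n2 (L : 'M[R]_m1) (E : 'M_(m1, n1))
    (Ip : 'M_n1) (f : 'M_(n1, n2)) (Ip1 Ix I2 : 'M_n2) (p1 : 'M_(n2, m2)) (B : 'M_m2) :
  E *m Ip = L *m E -> Ip *m f = f *m Ip1 -> I2 *m p1 = p1 *m B ->
  E *m f *m (Ip1 *m Ix *m I2) *m p1 = L *m (E *m f *m Ix *m p1) *m B.
Proof. by move=> e1 e2 e3; rewrite -!mulmxA e3 (mulmxA f) -e2 !mulmxA e1. Qed.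

Definition cusp_support (C : fieldType) (F : finFieldType) n r d
    (tau : mx_representation C 'GL_r[F] d) e (X : mx_representation C 'GL_(n * r)[F] e) :=
  exists2 f : 'M_(e, cusp_dim F n r d), row_free f &
    forall g, X g *m f = f *m cusp_ind n tau g.

Section Vanish.
Variables (C : numClosedFieldType) (F : finFieldType) (N t : nat) (n r d : 'I_t -> nat).
Hypotheses (n0 : forall i, (0 < n i)%N) (r0 : forall i, (0 < r i)%N).
Hypotheses (N0 : (0 < N)%N) (eN : (\sum_i n i * r i = N)%N).
Variable tau : forall i, mx_representation C 'GL_(r i)[F] (d i).
Hypothesis irr_tau : forall i, mx_irreducible (tau i).
Hypothesis cusp_tau : forall i, cuspidal (tau i).
Hypothesis nsim : forall i j, i != j -> ~ GL_rsim (tau i) (tau j).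

Local Notation s := (fun i => n i * r i)%N.
Local Notation Pi i := (parabolic_group F (n i * r i) (fun _ : 'I_(n i) => r i)).
Local Notation Ti i := (levi_repr (n i * r i) (fun _ : 'I_(n i) => tau i)).

Variables (e e' : 'I_t -> nat).
Variable V : forall i, mx_representation C 'GL_(n i * r i)[F] (e i).
Variable V' : forall i, mx_representation C 'GL_(n i * r i)[F] (e' i).
Hypothesis sV : forall i, cusp_support (tau i) (V i).
Hypothesis sV' : forall i, cusp_support (tau i) (V' i).
Hypothesis irrV : forall i, mx_irreducible (V i).
Hypothesis irrV' : forall i, mx_irreducible (V' i).

Variable f : 'M[C]_(HC_dim F N s e, HC_dim F N s e').
Hypothesis hom_f : forall g, HC_ind N V g *m f = f *m HC_ind N V' g.

Local Notation G := 'GL_N[F]%G.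
Local Notation P := (parabolic_group F N s).
Let sPG : P \subset G. Proof. by apply/subsetP => x _; rewrite inE. Qed.
Let s0 i : (0 < s i)%N. Proof. by rewrite muln_gt0 n0 r0. Qed.
Let E := ind_unit G (levi_repr N V).
Let E' := ind_unit G (levi_repr N V').
Let p1 := ind_eval G (levi_repr N V').
Let Ig x := ind_mx G (levi_repr N V) x.
Let Ig' x := ind_mx G (levi_repr N V') x.
(** The kernel of the intertwiner f: its value at x is the component at the coset of
    x^-1 of the restriction of f to the inducing representation. *)
Definition ind_kernel x := E *m f *m Ig' x *m p1.

Let Ig'M x y : Ig' (x * y)%g = Ig' x *m Ig' y.
Proof. by have := @repr_mxM _ _ _ _ (HC_ind N V') x y; apply; rewrite inE. Qed.

Lemma ind_kernelM p x p' : p \in P -> p' \in P ->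
  ind_kernel (p * x * p')%g = levi_mx V p *m ind_kernel x *m levi_mx V' p'.
Proof.
move=> Pp Pp'; rewrite /ind_kernel (Ig'M (p * x)%g p') (Ig'M p x).
have e1 : Ig' p' *m p1 = p1 *m levi_mx V' p' := ind_evalP _ sPG Pp'.
have e2 : E *m Ig p = levi_mx V p *m E := ind_unitP _ sPG Pp.
have e3 : Ig p *m f = f *m Ig' p := hom_f p.
exact: mulmx_sandwich e2 e3 e1.
Qed.

(** Translating by the Levi subgroup and composing with the maps from and to the
    cuspidal representations turns the kernel into one to which
    [kernel_off_parabolic] applies; as the maps generate and cogenerate, nothing is
    lost. *)
Lemma ind_kernel_off x : x \notin P -> ind_kernel x = 0.
Proof.
move=> nPx.
have data i : exists iota : 'M_(tens_dim (fun _ : 'I_(n i) => d i), e i),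
    (forall p, p \in Pi i -> Ti i p *m iota = iota *m V i p) /\
    (forall m (M : 'M_(e i, m)),
      (forall g, g \in 'GL_(n i * r i)[F]%G -> iota *m V i g *m M = 0) -> M = 0).
  have [fi free_fi hom_fi] := sV i.
  by apply: (frobenius_unit (subsetT _) free_fi) => g _; exact: hom_fi.
have data' i : exists pi : 'M_(e' i, tens_dim (fun _ : 'I_(n i) => d i)),
    (forall p, p \in Pi i -> V' i p *m pi = pi *m Ti i p) /\
    (forall m (M : 'M_(m, e' i)),
      (forall g, g \in 'GL_(n i * r i)[F]%G -> M *m V' i g *m pi = 0) -> M = 0).
  have [fi free_fi hom_fi] := sV' i.
  by apply: (frobenius_eval (subsetT _) free_fi) => g _; exact: hom_fi.
have [iota iotaP] := fin_all_exists data; have [pi piP] := fin_all_exists data'.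
pose psi y := rtens iota *m ind_kernel y *m rtens pi.
have psi0 y : y \notin P -> psi y = 0.
  apply: (@kernel_off_parabolic F N t n r n0 r0 N0 eN C d tau irr_tau cusp_tau psi _ nsim).
  move=> q g q' Qq Qq'; rewrite /psi ind_kernelM ?(fine_parabolic_sub Qq) ?(fine_parabolic_sub Qq') // !mulmxA.
  have -> : rtens iota *m levi_mx V q = cusp_levi_mx n tau q *m rtens iota.
    rewrite !rtensM; apply: eq_rtens => i; rewrite -(iotaP i).1 //.
    exact: fine_parabolic_levi Qq.
  have e2 : levi_mx V' q' *m rtens pi = rtens pi *m cusp_levi_mx n tau q'.
    rewrite !rtensM; apply: eq_rtens => i; rewrite (piP i).1 //.
    exact: fine_parabolic_levi Qq'.
  by rewrite -!mulmxA e2.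
apply: (@rtens_gen C t (fun i => {'GL_(n i * r i)[F]} : finType) _ _
  (fun i g => iota i *m V i g)).
  by move=> i M h; apply: (iotaP i).2 => g _; exact: h.
move=> u; apply: (@rtens_cogen C t (fun i => {'GL_(n i * r i)[F]} : finType) _ _
  (fun i g => V' i g *m pi i)).
  by move=> i M h; apply: (piP i).2 => g _; rewrite -mulmxA; exact: h.
move=> u'.
have [l [Pl lE _ _]] := diagGL_exists eN N0 s0 u.
have [l' [Pl' lE' _ _]] := diagGL_exists eN N0 s0 u'.
have Pll : (l * x * l')%g \notin P.
  by rewrite (groupMr _ (Pl' : l' \in P)) (groupMl _ (Pl : l \in P)).
have a1 : rtens (fun i => iota i *m V i (u i)) = rtens iota *m levi_mx V l.
  by rewrite rtensM; apply: eq_rtens => i; rewrite lE.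
have a2 : rtens (fun i => V' i (u' i) *m pi i) = levi_mx V' l' *m rtens pi.
  by rewrite rtensM; apply: eq_rtens => i; rewrite lE'.
have := psi0 _ Pll; rewrite /psi ind_kernelM // a1 a2; move: (ind_kernel x) => M.
by rewrite !mulmxA.
Qed.

(** A kernel supported on P is determined by its value at 1. *)
Lemma ind_unit_hom : E *m f = ind_kernel 1%g *m E'.
Proof.
apply/eqP; rewrite -subr_eq0; apply/eqP.
apply: (ind_eval_cogen sPG (rP := levi_repr N V')) => g Gg.
have e1 : E' *m Ig' g *m p1 = ext0 (levi_repr N V') g := ind_unit_eval _ Gg.
have e2 : E *m f *m Ig' g *m p1 = ind_kernel g by [].
rewrite -/(Ig' g) -/p1 !mulmxBl e2 -!(mulmxA (ind_kernel 1%g)) e1 /ext0.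
case: ifP => [Pg|nPg]; last by rewrite ind_kernel_off ?nPg // mulmx0 subr0.
have := ind_kernelM 1%g (group1 P) (Pg : g \in P).
rewrite !mul1g (levi_mx_repr N V).1 mul1mx => ->.
exact: subrr.
Qed.

Lemma ind_kernel1_hom (u : forall i, {'GL_(n i * r i)[F]}) :
  tens_mx (fun i => V i (u i)) *m ind_kernel 1%g = ind_kernel 1%g *m tens_mx (fun i => V' i (u i)).
Proof.
have [l [Pl lE _ _]] := diagGL_exists eN N0 s0 u.
have -> : tens_mx (fun i => V i (u i)) = levi_mx V l by apply: eq_tens_mx => i; rewrite lE.
have -> : tens_mx (fun i => V' i (u i)) = levi_mx V' l by apply: eq_tens_mx => i; rewrite lE.
have e1 := ind_kernelM 1%g (Pl : l \in P) (group1 P).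
have e2 := ind_kernelM 1%g (group1 P) (Pl : l \in P).
move: e1 e2; rewrite !mulg1 mul1g (levi_mx_repr N V).1 (levi_mx_repr N V').1 mulmx1 mul1mx.
by move=> <- <-.
Qed.

Lemma hom_unit_eq0 : ind_unit G (levi_repr N V) *m f = 0 -> f = 0.
Proof.
move=> Ef; apply: (ind_unit_gen sPG (rP := levi_repr N V)) => g Gg.
have e3 : Ig g *m f = f *m Ig' g := hom_f g.
by rewrite -/(Ig g) -mulmxA e3 mulmxA Ef mul0mx.
Qed.

End Vanish.

Section Main.
Variables (C : numClosedFieldType) (F : finFieldType) (N t : nat) (n r d : 'I_t -> nat).
Hypotheses (n0 : forall i, (0 < n i)%N) (r0 : forall i, (0 < r i)%N).
Hypotheses (N0 : (0 < N)%N) (eN : (\sum_i n i * r i = N)%N).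
Variable tau : forall i, mx_representation C 'GL_(r i)[F] (d i).
Hypothesis irr_tau : forall i, mx_irreducible (tau i).
Hypothesis cusp_tau : forall i, cuspidal (tau i).
Hypothesis nsim : forall i j, i != j -> ~ GL_rsim (tau i) (tau j).

Lemma HC_ind_irr (e : 'I_t -> nat) (V : forall i, mx_representation C 'GL_(n i * r i)[F] (e i)) :
  (forall i, cusp_support (tau i) (V i)) -> (forall i, mx_irreducible (V i)) ->
  mx_irreducible (HC_ind N V).
Proof.
move=> sV irrV; apply: scalar_cent_irr.
  rewrite /HC_dim /ind_dim sum_nat_const muln_gt0; apply/andP; split.
    rewrite card_ord; apply/card_gt0P; exists (rcoset (parabolic F N (fun i => n i * r i)%N) 1%g).
    by apply/rcosetsP; exists 1%g; [exact: group1 | rewrite rcosetE].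
  rewrite /tens_dim card_fprod; apply: prodn_gt0 => i; rewrite card_ord.
  by case/mx_irrP: (irrV i).
move=> f /centgmxP cf.
have hom_f g : HC_ind N V g *m f = f *m HC_ind N V g by rewrite cf ?inE.
have := tens_schur_scalar irrV (ind_kernel1_hom n0 r0 N0 eN hom_f).
case/is_scalar_mxP => c ec; apply/is_scalar_mxP; exists c.
apply/eqP; rewrite -subr_eq0; apply/eqP.
have hom_f' g : HC_ind N V g *m (f - c%:M) = (f - c%:M) *m HC_ind N V g.
  by rewrite mulmxBr mulmxBl hom_f scalar_mxC.
apply: (hom_unit_eq0 hom_f'); rewrite mulmxBr.
rewrite (ind_unit_hom n0 r0 N0 eN irr_tau cusp_tau nsim sV sV hom_f) ec.
by rewrite scalar_mxC subrr.
Qed.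

Lemma HC_ind_components (e e' : 'I_t -> nat)
    (V : forall i, mx_representation C 'GL_(n i * r i)[F] (e i))
    (V' : forall i, mx_representation C 'GL_(n i * r i)[F] (e' i)) :
  (forall i, cusp_support (tau i) (V i)) -> (forall i, mx_irreducible (V i)) ->
  (forall i, cusp_support (tau i) (V' i)) -> (forall i, mx_irreducible (V' i)) ->
  mx_rsim (HC_ind N V) (HC_ind N V') -> forall i, ~ ~ mx_rsim (V i) (V' i).
Proof.
move=> sV irrV sV' irrV' [f ed free_f hom_f] i nsimV.
have hom_f' g : HC_ind N V g *m f = f *m HC_ind N V' g by apply: hom_f; rewrite inE.
have phi0 := tens_schur_neq (ind_kernel1_hom n0 r0 N0 eN hom_f') irrV irrV' nsimV.
have f0 : f = 0.
  apply: (hom_unit_eq0 hom_f').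
  by rewrite (ind_unit_hom n0 r0 N0 eN irr_tau cusp_tau nsim sV sV' hom_f') phi0 mul0mx.
have := HC_ind_irr sV irrV; case/mx_irrP => d0 _.
by move: free_f; rewrite f0 /row_free mxrank0 => /eqP e0; rewrite -e0 in d0.
Qed.
End Main.

(** * Dominance of partitions *)

Section Partitions.
Local Open Scope nat_scope.

Lemma sumn_take_le (la : seq nat) k l : k <= l -> sumn (take k la) <= sumn (take l la).
Proof.
by move=> lekl; rewrite -(take_takel la lekl) -{2}(cat_take_drop k (take l la)) sumn_cat leq_addr.
Qed.

Lemma sumn_takeS (la : seq nat) k : sumn (take k.+1 la) = sumn (take k la) + nth 0 la k.
Proof.
case: (ltnP k (size la)) => [lt|ge]; first by rewrite (take_nth 0) // sumn_rcons.
by rewrite nth_default // !take_oversize ?addn0 // leqW.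
Qed.

Lemma reshape_index_lt (la : seq nat) x k : x < sumn la ->
  (reshape_index la x < k) = (x < sumn (take k la)).
Proof.
move=> ltx; have ltc := reshape_offsetP ltx.
rewrite -{2}(reshape_indexK la x) /flatten_index.
case: ltnP => h.
  have := sumn_take_le la h; rewrite sumn_takeS; lia.
by have := sumn_take_le la h; lia.
Qed.

Section Dominance.
Variables (n : nat) (la mu : seq nat).
Hypotheses (Pla : is_partition n la) (Pmu : is_partition n mu).

Let sla : sumn la = n. Proof. by case/and3P: Pla => _ _ /eqP. Qed.
Let smu : sumn mu = n. Proof. by case/and3P: Pmu => _ _ /eqP. Qed.

Lemma card_first_rows (nu : seq nat) k : sumn nu = n ->
  #|[set x : 'I_n | reshape_index nu x < k]| = sumn (take k nu).
Proof.
move=> snu; have le : sumn (take k nu) <= n.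
  by rewrite -snu -{2}(cat_take_drop k nu) sumn_cat leq_addr.
have winj : injective (widen_ord le) by move=> x y /(congr1 val) /= /val_inj.
rewrite -[RHS]card_ord -(card_imset _ winj).
apply: eq_card => x; rewrite inE reshape_index_lt ?snu //.
apply/idP/imsetP => [lt|[y _ ->]]; last exact: ltn_ord y.
by exists (Ordinal lt) => //; apply: val_inj.
Qed.

(** The hypothesis on p says that each column of la receives at most one element of
    each row of mu.  Hence a column of la receives at most min(k, c) elements of the
    first k rows of mu, where c is its length, and min(k, c) is the number of its
    cells in the first k rows of la. *)
Lemma dominance_of_columns (p : 'S_n) :
  (forall x y : 'I_n, x != y -> reshape_index mu x = reshape_index mu y ->
     reshape_offset la (p x) != reshape_offset la (p y)) ->
  forall k, sumn (take k mu) <= sumn (take k la).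
Proof.
move=> hp k; rewrite -!card_first_rows //.
pose X c := [set x : 'I_n | (reshape_index mu x < k) && (reshape_offset la (p x) == c)].
pose Y c := [set y : 'I_n | (reshape_index la y < k) && (reshape_offset la y == c)].
have ofs_lt (y : 'I_n) : reshape_offset la y < n.+1.
  by rewrite ltnS (leq_trans _ (ltnW (ltn_ord y))) // /reshape_offset leq_subr.
have splitX : #|[set x : 'I_n | reshape_index mu x < k]| = \sum_(c < n.+1) #|X c|.
  rewrite -sum1_card (partition_big (fun x => Ordinal (ofs_lt (p x))) xpredT) //=.
  apply: eq_bigr => c _; rewrite -sum1_card; apply: eq_bigl => x.
  by rewrite !inE -val_eqE.
have splitY : #|[set x : 'I_n | reshape_index la x < k]| = \sum_(c < n.+1) #|Y c|.
  rewrite -sum1_card (partition_big (fun x => Ordinal (ofs_lt x)) xpredT) //=.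
  apply: eq_bigr => c _; rewrite -sum1_card; apply: eq_bigl => x.
  by rewrite !inE -val_eqE.
rewrite splitX splitY; apply: leq_sum => c _.
case: (boolP [forall y : 'I_n, (reshape_offset la y == c) ==> (reshape_index la y < k)]).
  move=> /forallP all_lt; rewrite -(card_imset _ (@perm_inj _ p)); apply: subset_leq_card.
  apply/subsetP => y /imsetP[x]; rewrite !inE => /andP[_ ec] ->.
  by rewrite ec (implyP (all_lt (p x))).
move=> /forallPn[y0]; rewrite negb_imply -leqNgt => /andP[/eqP cy0 ley0].
have rowlt : reshape_index la y0 < size la by rewrite reshape_indexP // sla.
have la_lt i : i < k -> c < nth 0 la i.
  move=> lti; apply: (@leq_trans (nth 0 la (reshape_index la y0))).
    by rewrite -cy0 reshape_offsetP // sla.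
  have lei : i <= reshape_index la y0 by rewrite ltnW // (leq_trans lti).
  case/and3P: Pla => sorted_la _ _.
  have := @sorted_leq_nth _ geq _ _ 0 _ sorted_la i (reshape_index la y0).
  apply=> //; first by move=> a b d /= h1 h2; apply: leq_trans h2 h1.
    by move=> a; exact: leqnn.
  by rewrite inE (leq_ltn_trans lei).
apply: (@leq_trans k).
  have inj : {in X c &, injective (fun x : 'I_n => inord (reshape_index mu x) : 'I_k.-1.+1)}.
    move=> x y; rewrite !inE => /andP[ltx ex] /andP[lty ey] /(congr1 val).
    have k0 : 0 < k by exact: leq_ltn_trans ltx.
    rewrite /= !inordK ?prednK // => e; apply/eqP; apply: contraT => ne.
    by have := hp _ _ ne e; rewrite (eqP ex) (eqP ey) eqxx.
  case: (posnP k) => [k0|k0].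
    have -> : X c = set0 by apply/setP => x; rewrite !inE k0.
    by rewrite cards0.
  rewrite -(card_in_imset inj); apply: leq_trans (max_card _) _.
  by rewrite card_ord prednK.
have fl_lt (i : 'I_k) : flatten_index la i c < n.
  by apply: leq_trans (flatten_indexP (la_lt _ (ltn_ord i))) _; rewrite sla.
have injf : injective (fun i : 'I_k => Ordinal (fl_lt i)).
  move=> i j /(congr1 val) /= e; apply: val_inj => /=.
  by rewrite -(flatten_indexKl (la_lt _ (ltn_ord i))) e flatten_indexKl // la_lt.
rewrite -[X in X <= _]card_ord -(card_imset _ injf); apply: subset_leq_card.
apply/subsetP => y /imsetP[i _ ->]; rewrite inE /=.
by rewrite flatten_indexKl ?la_lt // flatten_indexKr ?la_lt // ltn_ord eqxx.
Qed.

Lemma partition_eq : (forall k, sumn (take k mu) = sumn (take k la)) -> la = mu.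
Proof.
move=> h; have enth k : nth 0 la k = nth 0 mu k.
  by have := h k.+1; rewrite !sumn_takeS h => /addnI.
case/and3P: Pla => _ la0 _; case/and3P: Pmu => _ mu0 _.
have esz : size la = size mu.
  apply/eqP; rewrite eqn_leq; apply/andP; split; rewrite leqNgt; apply/negP => lt.
    have := mem_nth 0 lt; rewrite enth nth_default // => z; by rewrite z in la0.
  have := mem_nth 0 lt; rewrite -enth nth_default // => z; by rewrite z in mu0.
by apply: (eq_from_nth (x0 := 0) esz) => k _.
Qed.

End Dominance.

End Partitions.

(** * Invariants of Specht modules *)

(** The reflections that generate the row stabilizer of mu. *)
Definition row_adjacent n (mu : seq nat) (k : 'I_n.-1) :=
  reshape_index mu k == reshape_index mu k.+1.

Section Specht.
Variables (C : numClosedFieldType) (n : nat) (la : seq nat).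
Let Sn : {group 'S_n} := [set: 'S_n]%G.
Local Notation reg := (regular_repr C Sn).
Local Notation dl g := (delta_mx 0 (gring_index Sn g) : 'rV[C]_(gcard Sn)).
Local Notation yla := (young_symmetrizer C n la).

Lemma delta_reg g x : dl g *m reg x = dl (g * x)%g.
Proof. by rewrite -rowE rowK gring_indexK ?inE. Qed.

Lemma row_stab_group_set : group_set (row_stab n la).
Proof.
apply/group_setP; split=> [|x y].
  by rewrite inE; apply/forallP => k; rewrite perm1.
rewrite !inE => /forallP hx /forallP hy; apply/forallP => k.
by rewrite permM (eqP (hy _)).
Qed.
Local Notation R := (Group row_stab_group_set).

Lemma col_stabMr c c0 : c0 \in col_stab n la ->
  ((c * c0)%g \in col_stab n la) = (c \in col_stab n la).
Proof.
rewrite !inE => /forallP h; apply: eq_forallb => k.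
by rewrite permM (eqP (h _)).
Qed.

Lemma row_col_stab1 c : c \in row_stab n la -> c \in col_stab n la -> c = 1%g.
Proof.
rewrite !inE => /forallP hr /forallP hc; apply/permP => k; rewrite perm1.
apply: val_inj => /=; rewrite -(reshape_indexK la (c k)) (eqP (hr k)) (eqP (hc k)).
exact: reshape_indexK.
Qed.

Lemma col_stab1 : 1%g \in col_stab n la.
Proof. by rewrite inE; apply/forallP => k; rewrite perm1. Qed.

Lemma young_col c0 : c0 \in col_stab n la -> yla *m reg c0 = (-1) ^+ (c0 : bool) *: yla.
Proof.
move=> Cc0; rewrite /young_symmetrizer mulmx_suml scaler_sumr; apply: eq_bigr => x _.
rewrite mulmx_suml scaler_sumr [RHS](reindex_inj (mulIg c0)) /=.
apply: eq_big => [c|c _]; first by rewrite col_stabMr.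
rewrite -scalemxAl delta_reg mulgA scalerA odd_permM signr_addb.
by rewrite mulrC -mulrA -signr_addb addbb mulr1.
Qed.

(** The sum of the right translates of the Young symmetrizer by the row stabilizer R.
    Its coefficients over R add up to |R|^2, because x' c x is in R only if the
    element c of the column stabilizer is 1. *)
Lemma young_row_inv : exists u : 'rV[C]_(gcard Sn), [/\ u != 0, (u <= cyclic_mx reg yla)%MS &
  forall s, s \in row_stab n la -> u *m reg s = u].
Proof.
pose u := \sum_(x in R) yla *m reg x; exists u.
(* The linear functional that adds the coefficients over R. *)
pose fm : 'cV[C]_(gcard Sn) := \col_i (enum_val i \in R)%:R.
have fmE g : dl g *m fm = (g \in R)%:R%:M.
  by rewrite -rowE; apply/rowP => i; rewrite !mxE gring_indexK ?inE // ord1 mulr1n.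
split.
- have : u *m fm = (#|R| * #|R|)%:R%:M.
    rewrite mulmx_suml (eq_bigr (fun _ => #|R|%:R%:M)) => [|x Rx]; last first.
      rewrite /young_symmetrizer !mulmx_suml (eq_bigr (fun _ => 1%:M)) => [|x' Rx'].
        by rewrite sumr_const -scaler_nat scalemx1.
      rewrite !mulmx_suml (bigD1 1%g) ?col_stab1 //= big1 => [|c /andP[Cc c1]].
        by rewrite odd_perm1 expr0 scale1r delta_reg fmE addr0 mulg1 groupM.
      rewrite -!scalemxAl delta_reg fmE groupMr // groupMl //.
      case: (boolP (c \in R)) => [Rc|_]; last by rewrite raddf0 scaler0.
      by rewrite (row_col_stab1 Rc Cc) eqxx in c1.
    by rewrite sumr_const -scaler_nat scale_scalar_mx natrM.
  move=> ufm; apply: contraTneq (cardG_gt0 R) => u0; move: ufm; rewrite u0 mul0mx.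
  move/matrixP/(_ 0 0); rewrite !mxE /= mulr1n => /esym/eqP.
  by rewrite pnatr_eq0 muln_eq0 orbb -lt0n => /eqP->.
- apply/cyclic_mxP; exists (\sum_(x in R) reg x); last by rewrite mulmx_sumr.
  apply/envelop_mxP; exists (fun x => (x \in R)%:R).
  rewrite big_mkcond [RHS](eq_bigl xpredT) => [|x]; last by rewrite inE.
  by apply: eq_bigr => x _; case: (x \in R); rewrite ?scale1r ?scale0r.
move=> s Rs; rewrite /u mulmx_suml [RHS](reindex_inj (mulIg s)) /=.
apply: eq_big => [x|x _]; first by rewrite (groupMr (G := R) _ Rs).
by rewrite -mulmxA -repr_mxM ?inE.
Qed.

Lemma simple_refl_row_stab k : row_adjacent la k -> simple_refl k \in row_stab n la.
Proof.
move=> /eqP adj; rewrite inE; apply/forallP => x; rewrite /simple_refl.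
by case: tpermP => [->|->|//] /=; rewrite adj.
Qed.

Lemma reshape_index_mono (mu : seq nat) i j : (i <= j)%N -> (j < sumn mu)%N ->
  (reshape_index mu i <= reshape_index mu j)%N.
Proof.
move=> leij ltj; rewrite leqNgt reshape_index_lt // -leqNgt.
rewrite -{1}(reshape_indexK mu i) in leij *.
have lti := leq_ltn_trans leij ltj; move: leij.
rewrite reshape_indexK => leij; apply: leq_trans leij.
by rewrite -{2}(reshape_indexK mu i) leq_addr.
Qed.

(** By conjugation, from the transpositions of neighbours. *)
Lemma adjacent_tperm (K : {group 'S_n}) (mu : seq nat) : sumn mu = n ->
  (forall k : 'I_n.-1, row_adjacent mu k -> simple_refl k \in K) ->
  forall i j : 'I_n, reshape_index mu i = reshape_index mu j -> tperm i j \in K.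
Proof.
move=> smu hK.
have main m (i j : 'I_n) : (j = i + m :> nat)%N ->
    reshape_index mu i = reshape_index mu j -> tperm i j \in K.
  elim: m i j => [|m IH] i j eij erow.
    by rewrite (_ : i = j) ?tperm1 ?group1 //; apply: val_inj; rewrite /= eij addn0.
  have ltj' : (i + m < n)%N by rewrite (leq_ltn_trans _ (ltn_ord j)) // eij addnS.
  pose j' := Ordinal ltj'.
  have erow' : reshape_index mu i = reshape_index mu j'.
    apply/eqP; rewrite eqn_leq reshape_index_mono ?smu //= ?leq_addr //.
    by rewrite erow reshape_index_mono ?smu //= eij addnS.
  have K1 := IH i j' erefl erow'.
  have ltk : (i + m < n.-1)%N by rewrite -ltnS prednK ?(leq_ltn_trans _ (ltn_ord j)) // -addnS -eij.
  have K2 : tperm j' j \in K.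
    have -> : tperm j' j = simple_refl (Ordinal ltk).
      by rewrite /simple_refl; congr tperm; apply: val_inj; rewrite /= ?eij ?addnS.
    by apply: hK; rewrite /row_adjacent /= -[X in reshape_index _ X == _]/(val j') -erow' erow eij addnS.
  have ne1 : i != j by rewrite -val_eqE /= eij -[X in X != _]addn0 eqn_add2l.
  case: (posnP m) => [m0|m0].
    by move: K2; rewrite (_ : j' = i) //; apply: val_inj; rewrite /= m0 addn0.
  have ne2 : i != j' by rewrite -val_eqE /= -[X in X != _]addn0 eqn_add2l eq_sym -lt0n.
  have ne3 : j' != j by rewrite -val_eqE /= eij eqn_add2l neq_ltn ltnSn.
  have <- : (tperm i j' ^ tperm j' j)%g = tperm i j.
    by rewrite tpermJ tpermL tpermD // eq_sym.
  by rewrite groupJ.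
move=> i j erow; case: (leqP i j) => h; first by apply: (main (j - i)%N); rewrite ?subnKC.
by rewrite tpermC; apply: (main (i - j)%N); rewrite ?subnKC // ltnW.
Qed.

(** Let K be the stabilizer of u.  Some translate by g of the Young symmetrizer is not
    killed by the sum over K.  If a transposition of K became, after conjugation by
    g, a column transposition of la, that product would equal its own opposite. *)
Lemma young_inv_columns (mu : seq nat) (u : 'rV_(gcard Sn)) : sumn mu = n ->
  u != 0 -> (u <= cyclic_mx reg yla)%MS ->
  (forall k : 'I_n.-1, row_adjacent mu k -> u *m reg (simple_refl k) = u) ->
  exists p : 'S_n, forall x y : 'I_n, x != y -> reshape_index mu x = reshape_index mu y ->
     reshape_offset la (p x) != reshape_offset la (p y).
Proof.
move=> smu u0 /cyclic_mxP[A /envelop_mxP[a defA] defu] inv.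
pose K := rstab_group reg u.
have KE x : (x \in K) = (u *m reg x == u) by rewrite inE inE.
have hK k : row_adjacent mu k -> simple_refl k \in K by move=> adj; rewrite KE inv.
have tK := adjacent_tperm smu hK.
pose SK := \sum_(x in K) reg x.
have uSK : u *m SK != 0.
  rewrite mulmx_sumr (eq_bigr (fun _ => u)) => [|x]; last by rewrite KE => /eqP.
  by rewrite sumr_const -scaler_nat scaler_eq0 negb_or u0 pnatr_eq0 -lt0n cardG_gt0.
have [g gSK] : exists g, yla *m reg g *m SK != 0.
  apply/existsP; apply: contraR uSK; rewrite negb_exists => /forallP h.
  have defu' : u = \sum_(x in Sn) a x *: (yla *m reg x).
    by rewrite defu defA mulmx_sumr; apply: eq_bigr => x _; rewrite scalemxAr.
  rewrite defu' mulmx_suml big1 // => x _.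
  by rewrite -scalemxAl (eqP (negbNE (h x))) scaler0.
exists g^-1%g => x y ne erow; apply: contraNneq gSK => ecol.
pose tau := tperm x y; pose c0 := (tau ^ g^-1)%g.
have tauSK : reg tau *m SK = SK.
  rewrite mulmx_sumr [RHS](reindex_inj (mulgI tau)) /=.
  apply: eq_big => [z|z _]; first by rewrite groupMl // tK.
  by rewrite repr_mxM ?inE.
have Cc0 : c0 \in col_stab n la.
  rewrite /c0 tpermJ inE; apply/forallP => z.
  by case: tpermP => [->|->|//]; rewrite ecol.
have oddc0 : (c0 : bool) = true by rewrite /c0 odd_permJ odd_tperm ne.
have E : yla *m reg g *m SK = - (yla *m reg g *m SK).
  rewrite -{1}tauSK mulmxA -(mulmxA yla) -repr_mxM ?inE //.
  have -> : (g * tau = c0 * g)%g by rewrite /c0 conjgE invgK !mulgA mulgKV.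
  by rewrite repr_mxM ?inE // !mulmxA (young_col Cc0) oddc0 expr1 scaleN1r !mulNmx.
have : (2%:R : C) *: (yla *m reg g *m SK) = 0.
  by rewrite scaler_nat mulr2n {2}E subrr.
by move/eqP; rewrite scaler_eq0 pnatr_eq0.
Qed.

End Specht.

(** Nonzero vectors on which the Hecke algebra of the row stabilizer of mu acts
    through its index character. *)
Definition refl_invariants (C : fieldType) n (mu : seq nat) q e (T : 'I_n.-1 -> 'M[C]_e) :=
  exists2 v : 'rV_e, v != 0 & forall k, row_adjacent mu k -> v *m T k = q *: v.

Section SpechtInv.
Variables (C : numClosedFieldType) (n : nat) (la mu : seq nat).
Let Sn : {group 'S_n} := [set: 'S_n]%G.

Lemma specht_invariants :
  refl_invariants la 1 (fun k => specht_repr C n la (@simple_refl n k)).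
Proof.
have [u [u0 cu inv]] := young_row_inv C n la.
exists (in_submod (cyclic_mx (regular_repr C Sn) (young_symmetrizer C n la)) u).
  by rewrite -(val_submod_eq0 (U := cyclic_mx (regular_repr C Sn) (young_symmetrizer C n la))) in_submodK.
move=> k adj; apply: val_submod_inj; rewrite scale1r val_submodJ ?inE //.
by rewrite in_submodK // inv // simple_refl_row_stab.
Qed.

Lemma specht_invariants_dominance : is_partition n la -> is_partition n mu ->
  refl_invariants mu 1 (fun k => specht_repr C n la (@simple_refl n k)) ->
  forall k, (sumn (take k mu) <= sumn (take k la))%N.
Proof.
move=> Pla Pmu [v v0 inv].
have smu : sumn mu = n by case/and3P: Pmu => _ _ /eqP.
have [] := @young_inv_columns C n la mu (val_submod v) smu.
- by rewrite val_submod_eq0.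
- exact: val_submodP.
- move=> k /inv; rewrite scale1r => e.
  by rewrite -[RHS](congr1 (val_submod (U:=_)) e) val_submodJ ?inE.
by move=> p hp k; apply: dominance_of_columns hp k.
Qed.
End SpechtInv.

(** * Symmetrizers in Hecke algebras *)

Section Symmetrizer.
Variables (A : comNzRingType) (q : A) (m e : nat) (T : nat -> 'M[A]_e).
Hypothesis quad : forall k, (k < m)%N -> T k *m T k = (q - 1) *: T k + q%:M.
Hypothesis braid : forall k, (k.+1 < m)%N -> T k *m T k.+1 *m T k = T k.+1 *m T k *m T k.+1.
Hypothesis comm : forall k l, (k.+1 < l)%N -> (l < m)%N -> T k *m T l = T l *m T k.
Variable J : pred nat.

(** The product T_b T_(b-1) ... with j factors. *)
Fixpoint descend b j : 'M[A]_e :=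
  if j is j'.+1 then descend b j' *m T (b - j') else 1%:M.

(** The number of consecutive indices b, b - 1, ... that belong to J. *)
Fixpoint run b : nat :=
  if J b then (if b is b'.+1 then (run b').+1 else 1%N) else 0%N.

(** The sum of T_w over the distinguished coset representatives of the parabolic
    subgroup of the generators of J below b, in that of the generators up to b. *)
Definition coset_sum b : 'M[A]_e := \sum_(j < (run b).+1) descend b j.

Fixpoint symmetrizer b : 'M[A]_e :=
  if b is b'.+1 then symmetrizer b' *m coset_sum b' else 1%:M.

Lemma run_le b : (run b <= b.+1)%N.
Proof. by elim: b => [|b IH] /=; case: (J _). Qed.

Lemma run_J b i : (i < run b)%N -> J (b - i)%N.
Proof.
elim: b i => [|b IH] i.
  by rewrite sub0n /=; case: (J 0%N).
rewrite /=; case: ifP => // Jb.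
by case: i => [|i] lt; [rewrite subn0 | rewrite subSS IH].
Qed.

Lemma run_end b : (run b <= b)%N -> ~~ J (b - run b)%N.
Proof.
elim: b => [|b IH] /=; case: ifP => // Jb; try by rewrite subn0 Jb.
Qed.

Lemma descend_comm b j k : (b < m)%N -> (k + j < b)%N ->
  descend b j *m T k = T k *m descend b j.
Proof.
move=> ltb; elim: j => [|j IH] lt /=; first by rewrite mul1mx mulmx1.
rewrite -mulmxA -comm; [|lia|lia].
by rewrite !mulmxA IH //; lia.
Qed.

(** The braid relation moves T_k to the left across a descending product that contains
    both k and k - 1, and turns it into T_(k-1). *)
Lemma descend_shift b i j : (b < m)%N -> (i.+1 < j)%N -> (j <= b.+1)%N ->
  descend b j *m T (b - i) = T (b - i.+1) *m descend b j.
Proof.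
move=> ltb; elim: j => // j IH; rewrite ltnS leq_eqVlt => /orP[/eqP<-|lt] lej.
  have -> : (b - i = (b - i.+1).+1)%N by lia.
  rewrite /= (_ : (b - i = (b - i.+1).+1)%N); last by lia.
  rewrite -!mulmxA (mulmxA (T (b - i.+1).+1)) -braid; last by lia.
  by rewrite !mulmxA descend_comm //; lia.
rewrite /= -mulmxA comm; [|lia|lia].
by rewrite !mulmxA IH //; lia.
Qed.

Lemma descendS b j : descend b j.+1 = descend b j *m T (b - j).
Proof. by []. Qed.

(** The symmetrizer is the sum of T_w over the parabolic subgroup of J.  In the last
    factor, multiplication by T_k, where k = b - i, permutes the descending products
    of lengths i and i + 1, up to the quadratic relation; it moves to the left across
    all the others and is absorbed by the previous factor. *)
Lemma symmetrizerM b k : (b <= m)%N -> (k < b)%N -> J k ->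
  symmetrizer b *m T k = q *: symmetrizer b.
Proof.
elim: b k => // b IH k ltb ltk Jk /=; rewrite /coset_sum.
set x := symmetrizer b; set R := run b.
have IHb l : (l < b)%N -> J l -> x *m T l = q *: x by apply: IH; exact: ltnW.
have Rle := run_le b.
case: (ltnP (k + R) b) => [ltkR|geR].
  rewrite -mulmxA mulmx_suml.
  rewrite (eq_bigr (fun j : 'I_R.+1 => T k *m descend b j)) => [|j _]; last first.
    by rewrite descend_comm //; have := ltn_ord j; lia.
  by rewrite -mulmx_sumr mulmxA IHb ?scalemxAl //; lia.
pose i := (b - k)%N.
have ltiR : (i < R)%N.
  rewrite /i; case: (ltngtP (b - k) R) => //; [lia|move=> eR].
  have nJ : ~~ J (b - R)%N by apply: run_end; rewrite -/R -eR leq_subr.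
  by move: nJ; rewrite -eR subKn // Jk.
have ek : k = (b - i)%N by rewrite subKn.
pose D j := x *m descend b j.
have commD j : (j < i)%N -> D j *m T k = q *: D j.
  move=> lt; rewrite /D -mulmxA descend_comm //; last by lia.
  by rewrite mulmxA IHb ?scalemxAl //; lia.
have shiftD j : (i.+1 < j)%N -> (j <= R)%N -> D j *m T k = q *: D j.
  move=> lt le; rewrite /D -mulmxA {1}ek descend_shift //; last by lia.
  rewrite mulmxA IHb ?scalemxAl //; first by lia.
  by apply: run_J; rewrite -/R; lia.
have D1 : D i *m T k = D i.+1 by rewrite /D descendS -ek mulmxA.
have D2 : D i.+1 *m T k = (q - 1) *: D i.+1 + q *: D i.
  rewrite -D1 -[LHS]mulmxA quad; last by lia.
  by rewrite mulmxDr mul_mx_scalar -scalemxAr.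
(* The two products exchanged by T_k are singled out. *)
have splitS (G : nat -> 'M[A]_e) : \sum_(j < R.+1) G j =
    \sum_(0 <= j < i) G j + (G i + G i.+1) + \sum_(i.+2 <= j < R.+1) G j.
  rewrite -(big_mkord xpredT G) (big_cat_nat (n := i)) //=; last by lia.
  have -> : \sum_(i <= j < R.+1) G j = G i + (G i.+1 + \sum_(i.+2 <= j < R.+1) G j).
    by rewrite big_ltn; [congr (_ + _); rewrite big_ltn //; lia | lia].
  by rewrite !addrA.
rewrite mulmx_sumr mulmx_suml scaler_sumr.
rewrite (splitS (fun j => D j *m T k)) (splitS (fun j => q *: D j)).
congr (_ + _ + _).
- by apply: eq_big_nat => j /andP[_ lt]; exact: commD.
- by rewrite D1 D2 scalerBl scale1r addrA addrCA subrr addr0 addrC.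
by apply: eq_big_nat => j /andP[lt lt']; apply: shiftD.
Qed.

Lemma descend_eigen (v : 'rV[A]_e) b j : (b < m)%N ->
  (forall k, (k < m)%N -> J k -> v *m T k = q *: v) ->
  (j <= run b)%N -> v *m descend b j = q ^+ j *: v.
Proof.
move=> ltb hv; elim: j => [|j IH] le /=; first by rewrite mulmx1 expr0 scale1r.
rewrite mulmxA IH ?(ltnW le) // -scalemxAl hv ?scalerA ?exprSr //; last exact: run_J.
by lia.
Qed.

(** The scalar is the Poincare polynomial of the parabolic subgroup. *)
Lemma symmetrizer_eigen (v : 'rV[A]_e) b : (b <= m)%N ->
  (forall k, (k < m)%N -> J k -> v *m T k = q *: v) ->
  v *m symmetrizer b = (\prod_(c < b) \sum_(j < (run c).+1) q ^+ j) *: v.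
Proof.
move=> leb hv; elim: b leb => [|b IH] ltb /=; first by rewrite mulmx1 big_ord0 scale1r.
rewrite mulmxA IH ?(ltnW ltb) // big_ord_recr /= -scalemxAl -scalerA; congr (_ *: _).
rewrite /coset_sum mulmx_sumr scaler_suml; apply: eq_bigr => j _.
by rewrite descend_eigen // -ltnS.
Qed.

End Symmetrizer.

(** * Specialization of Hecke modules *)

(** Generators indexed by natural numbers, so that indices can be shifted freely; the
    value 0 outside the range is a dummy. *)
Definition ext_nat (A : comNzRingType) m e (T : 'I_m -> 'M[A]_e) (k : nat) : 'M[A]_e :=
  oapp T 0 (insub k).

Lemma ext_natE (A : comNzRingType) m e (T : 'I_m -> 'M[A]_e) (k : 'I_m) : ext_nat T k = T k.
Proof. by rewrite /ext_nat valK. Qed.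

Section Transfer.
Variables (C : numClosedFieldType) (n : nat) (mu : seq nat) (e : nat).
Variable TX : 'I_n.-1 -> 'M[{poly C}]_e.
Hypothesis hTX : hecke_rep 'X TX.

Let J k := reshape_index mu k == reshape_index mu k.+1.
Let m := n.-1.
Let sym := symmetrizer (ext_nat TX) J m.

Lemma sym_mul k : row_adjacent mu k -> sym *m TX k = 'X *: sym.
Proof.
case: hTX => quad braid comm Jk; rewrite -ext_natE.
apply: (@symmetrizerM _ 'X m e (ext_nat TX)) => // l.
- by move=> ltl; rewrite -[l]/(val (Ordinal ltl)) ext_natE quad.
- move=> ltl; have ltl' := ltnW ltl.
  rewrite -[l.+1]/(val (Ordinal ltl)) -[l]/(val (Ordinal ltl')) !ext_natE.
  exact: braid.
move=> l' lt ltl'; have ltl : (l < m)%N by apply: ltn_trans ltl'; exact: ltnW.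
rewrite -[l']/(val (Ordinal ltl')) -[l]/(val (Ordinal ltl)) !ext_natE.
exact: comm.
Qed.

Lemma map_symmetrizer (x : C) b :
  map_mx (horner_eval x) (symmetrizer (ext_nat TX) J b) =
  symmetrizer (ext_nat (fun k => map_mx (horner_eval x) (TX k))) J b.
Proof.
have ext_map k : map_mx (horner_eval x) (ext_nat TX k) =
    ext_nat (fun k => map_mx (horner_eval x) (TX k)) k.
  by rewrite /ext_nat; case: insubP => //= _; rewrite map_mx0.
have desc_map c j : map_mx (horner_eval x) (descend (ext_nat TX) c j) =
    descend (ext_nat (fun k => map_mx (horner_eval x) (TX k))) c j.
  by elim: j => [|j IH] /=; rewrite ?map_mx1 // map_mxM IH ext_map.
elim: b => [|b IH] /=; rewrite ?map_mx1 // map_mxM IH; congr (_ *m _).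
by rewrite /coset_sum raddf_sum; apply: eq_bigr => j _; exact: desc_map.
Qed.

(** Divides by X - x as long as possible. *)
Lemma factor_root (u : 'rV[{poly C}]_e) (x : C) : u != 0 ->
  exists l (w : 'rV_e), u = ('X - x%:P) ^+ l *: w /\ map_mx (horner_eval x) w != 0.
Proof.
case/rV0Pn => i; have [N] := ubnP (size (u 0 i)).
elim: N u => // N IH u ltN ui0.
have [u0|nz] := eqVneq (map_mx (horner_eval x) u) 0; last by exists 0%N, u; rewrite expr0 scale1r.
have rt j : root (u 0 j) x.
  by have /rowP/(_ j) := u0; rewrite !mxE /horner_eval => /rootP.
pose w := \row_j (u 0 j %/ ('X - x%:P)).
have uw : u = ('X - x%:P) *: w.
  apply/rowP => j; rewrite !mxE mulrC divpK // dvdp_XsubCl; exact: rt.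
have wi0 : w 0 i != 0 by apply: contraNneq ui0 => w0; rewrite uw mxE w0 mulr0.
have [|l [w' [ew nz]]] := IH w _ wi0.
  move: ltN; rewrite uw mxE size_monicM ?monicXsubC // size_XsubC /=.
  by [].
by exists l.+1, w'; split=> //; rewrite uw ew scalerA exprS.
Qed.

(** The constant extension of an invariant vector at X = a, multiplied by the
    symmetrizer, is invariant over C[X].  It is not 0, because at X = a it is a
    multiple of the given vector by a positive integer.  After division by the
    powers of X - x it does not vanish at X = x. *)
Lemma invariants_transfer (a : nat) (x : C) : (0 < a)%N ->
  refl_invariants mu a%:R (fun k => map_mx (horner_eval a%:R) (TX k)) ->
  refl_invariants mu x (fun k => map_mx (horner_eval x) (TX k)).
Proof.
move=> a0 [v0 nz inv].
pose u := map_mx polyC v0 *m sym.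
have uTX k : row_adjacent mu k -> u *m TX k = 'X *: u.
  by move=> adj; rewrite -mulmxA sym_mul // -scalemxAr.
have eval_const : map_mx (horner_eval a%:R) (map_mx polyC v0) = v0.
  by apply/rowP => j; rewrite !mxE /horner_eval hornerC.
have u_a : map_mx (horner_eval a%:R) u = (\prod_(c < m) \sum_(j < (run J c).+1) a%:R ^+ j) *: v0.
  rewrite map_mxM eval_const map_symmetrizer; apply: symmetrizer_eigen (leqnn m) _ => k ltk Jk.
  by rewrite -[k]/(val (Ordinal ltk)) ext_natE inv.
have u0 : u != 0.
  apply: contraNneq nz => u0; move: u_a; rewrite u0 map_mx0 => /esym/eqP.
  rewrite scaler_eq0 prodf_seq_eq0 => /orP[/hasP[c _ /=]|//].
  rewrite (eq_bigr (fun j : 'I__ => (a ^ j)%:R)) => [|j _]; last by rewrite natrX.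
  rewrite -natr_sum pnatr_eq0 sum_nat_eq0 => /forallP/(_ ord0).
  by rewrite expn0.
have [l [w [uw w0]]] := factor_root x u0.
exists (map_mx (horner_eval x) w) => // k adj.
have wTX : w *m TX k = 'X *: w.
  have E : ('X - x%:P) ^+ l *: (w *m TX k) = ('X - x%:P) ^+ l *: ('X *: w).
    by rewrite scalemxAl -uw uTX // uw !scalerA mulrC.
  have p0 : ('X - x%:P) ^+ l != 0 by rewrite expf_neq0 // polyXsubC_eq0.
  by apply/rowP => j; apply: (mulfI p0); have /rowP/(_ j) := E; rewrite !mxE.
by rewrite -map_mxM wTX map_mxZ /= /horner_eval hornerX.
Qed.

End Transfer.

Lemma refl_invariants_hom (C : fieldType) n mu q e e' (T : 'I_n.-1 -> 'M[C]_e)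
    (T' : 'I_n.-1 -> 'M[C]_e') (Q : 'M_(e, e')) : row_free Q ->
  (forall k, T k *m Q = Q *m T' k) -> refl_invariants mu q T -> refl_invariants mu q T'.
Proof.
move=> freeQ hQ [v v0 inv]; exists (v *m Q).
  by apply: contraNneq v0 => vQ; apply/eqP/(row_free_inj freeQ); rewrite mul0mx.
by move=> k adj; rewrite -mulmxA -hQ mulmxA inv // scalemxAl.
Qed.

Lemma refl_invariants_ext (C : fieldType) n mu q e (T T' : 'I_n.-1 -> 'M[C]_e) :
  T =1 T' -> refl_invariants mu q T -> refl_invariants mu q T'.
Proof. by move=> eT [v v0 inv]; exists v => // k adj; rewrite -eT inv. Qed.

Lemma rsim_invariants (C : numClosedFieldType) n e (nu : seq nat)
    (E : mx_representation C [set: 'S_n] e)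
    e1 (E1 : mx_representation C [set: 'S_n] e1) : mx_rsim E E1 ->
  refl_invariants nu 1 (fun k => E (@simple_refl n k)) ->
  refl_invariants nu 1 (fun k => E1 (@simple_refl n k)).
Proof.
case=> B _ freeB hB; apply: refl_invariants_hom freeB _ => k.
by apply: hB; rewrite inE.
Qed.

Section Attached.
Variables (C : numClosedFieldType) (n q : nat) (la mu : seq nat) (e e' : nat).
Variables (T : 'I_n.-1 -> 'M[C]_e) (T' : 'I_n.-1 -> 'M[C]_e').
Hypothesis q0 : (0 < q)%N.

Lemma attached_invariants : hecke_attached la q%:R T -> refl_invariants la q%:R T.
Proof.
case=> TX [hTX [E [simE ETX]] Tq].
apply: (refl_invariants_ext Tq); apply: (invariants_transfer hTX (a := 1)) => //.
apply: (refl_invariants_ext (T := fun k => E (@simple_refl n k))) => [k|]; first by rewrite -ETX.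
apply: rsim_invariants (mx_rsim_sym simE) (specht_invariants C n la).
Qed.

Lemma attached_dominance : is_partition n la -> is_partition n mu ->
  hecke_attached la q%:R T -> refl_invariants mu q%:R T ->
  forall k, (sumn (take k mu) <= sumn (take k la))%N.
Proof.
move=> Pla Pmu [TX [hTX [E [simE ETX]] Tq]] inv.
apply: (@specht_invariants_dominance C n la mu) => //.
apply: (rsim_invariants simE).
apply: (refl_invariants_ext (T := fun k => map_mx (horner_eval 1) (TX k))) => //.
apply: (invariants_transfer hTX (a := q)) => //.
by apply: refl_invariants_ext inv => k; rewrite Tq.
Qed.

End Attached.

Lemma attached_inj (C : numClosedFieldType) n q la mu e e'
    (T : 'I_n.-1 -> 'M[C]_e) (T' : 'I_n.-1 -> 'M[C]_e') (Q : 'M_(e, e')) (Q' : 'M_(e', e)) :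
  (0 < q)%N -> is_partition n la -> is_partition n mu ->
  hecke_attached la q%:R T -> hecke_attached mu q%:R T' ->
  Q *m Q' = 1%:M -> Q' *m Q = 1%:M -> (forall k, T k *m Q = Q *m T' k) -> la = mu.
Proof.
move=> q0 Pla Pmu aT aT' QQ' Q'Q hQ.
have freeQ : row_free Q by apply/row_freeP; exists Q'.
have freeQ' : row_free Q' by apply/row_freeP; exists Q.
have hQ' k : T' k *m Q' = Q' *m T k.
  by rewrite -[LHS]mul1mx -Q'Q !mulmxA -(mulmxA _ Q) -hQ -!mulmxA QQ' mulmx1.
have invT := attached_invariants aT; have invT' := attached_invariants aT'.
apply: (partition_eq Pla Pmu) => k; apply/eqP; rewrite eqn_leq.
rewrite (attached_dominance q0 Pla Pmu aT (refl_invariants_hom freeQ' hQ' invT')).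
by rewrite (attached_dominance q0 Pmu Pla aT' (refl_invariants_hom freeQ hQ invT)).
Qed.

(** * The label of a constituent *)

Section HeckeOp.
Variables (C : numClosedFieldType) (F : finFieldType) (n r d : nat).
Variable tau : mx_representation C 'GL_r[F] d.
Hypotheses (n0 : (0 < n)%N) (r0 : (0 < r)%N).

Local Notation sz := (fun _ : 'I_n => r).
Let sz_sum : (\sum_i sz i = n * r)%N. Proof. by rewrite sum_nat_const card_ord. Qed.
Let N0 : (0 < n * r)%N. Proof. by rewrite muln_gt0 n0. Qed.
Let sz0 i : (0 < sz i)%N. Proof. exact: r0. Qed.

Lemma block_perm_simple_unit (s : 'S_n) : (s * s = 1)%g ->
  \mxblock_(i < n, j < n) ((i == s j)%:R%:M : 'M[F]_r) \in unitmx.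
Proof.
move=> ss; set A := \mxblock_(i, j) _.
suff AA : A *m A = 1%:M by have [] := mulmx1_unit AA.
rewrite mul_mxblock -mxdiagZ; apply/eq_mxblock => i k.
rewrite (bigD1 (s k)) //= big1 => [|j ne]; last first.
  by rewrite (negPf ne) raddf0 mulmx0.
rewrite addr0 eqxx mulmx1 -permM ss perm1.
by case: (eqVneq i k) => _; rewrite ?conform_mx_id ?raddf0.
Qed.

(** A simple reflection has an identity block below the diagonal. *)
Lemma block_perm_off_parabolic (k : 'I_n.-1) :
  block_perm F r (simple_refl k) \notin parabolic F (n * r) sz.
Proof.
apply/negP => /(parabolicE sz_sum N0 sz0) h.
pose j : 'I_n := Ordinal (ltnW (simple_refl_proof k)).
pose i : 'I_n := Ordinal (simple_refl_proof k).
have ss : (simple_refl k * simple_refl k = 1)%g by rewrite /simple_refl tperm2.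
have := h i j ord0 ord0 (ltnSn k).
rewrite mxGL_block_pos ?block_perm_simple_unit // mxblockK /simple_refl tpermL eqxx mxE.
rewrite (_ : cast_ord (prednK (sz0 i)) ord0 = cast_ord (prednK (sz0 j)) ord0); last exact: val_inj.
by rewrite eqxx => /eqP; rewrite oner_eq0.
Qed.

(** Two such operators are proportional, T' = a T.  The two quadratic relations give
    q (1 - a^2) = (q - 1) a (a - 1) T.  But T moves the trivial coset away, so
    its component there is 0, and comparing these components gives a^2 = 1; and
    a = -1 would force T = 0, which the quadratic relation allows only on a zero
    space. *)
Lemma hecke_op_unique (k : 'I_n.-1) T T' : is_hecke_op tau k T -> is_hecke_op tau k T' -> T = T'.
Proof.
case=> [[c hT] quadT] [[c' hT'] quadT'].
pose G : {group {'GL_(n * r)[F]}} := 'GL_(n * r)[F]%G.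
pose P := parabolic_group F (n * r) sz.
have sPG : P \subset G by apply/subsetP => x _; rewrite inE.
pose rP := levi_repr (n * r) (fun _ : 'I_n => tau).
have tensE v g : cusp_tens tau v g = v *m (ind_unit G rP *m ind_mx G rP g).
  by rewrite /cusp_tens ind_tensE ?inE // mulmxA.
have gen0 (M : 'M_(cusp_dim F n r d)) : (forall v g, cusp_tens tau v g *m M = 0) -> M = 0.
  move=> h; apply: (ind_unit_gen sPG (rP := rP)) => g _.
  by apply/row_matrixP => i; rewrite rowE row0 mulmxA -tensE h.
pose q := hecke_param C F r.
have q0 : q != 0 by rewrite pnatr_eq0 -lt0n expn_gt0 (ltnW (card_finNzRing_gt1 F)).
have degen : T = 0 -> T = T'.
  move=> T0; move: quadT; rewrite T0 mulmx0 scaler0 add0r => /esym q1.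
  have one0 : 1%:M = 0 :> 'M[C]_(cusp_dim F n r d).
    by apply/eqP; rewrite -(inj_eq (scalerI q0)) scaler0 scalemx1 q1.
  by rewrite -[T']mul1mx one0 mul0mx.
have [c0|c_neq0] := eqVneq c 0.
  by apply: degen; apply: gen0 => v g; rewrite hT c0 scale0r.
pose a := c' / c.
have T'E : T' = a *: T.
  apply/eqP; rewrite -subr_eq0; apply/eqP; apply: gen0 => v g.
  by rewrite mulmxBr -scalemxAr hT hT' [a *: (c *: _)]scalerA divfK // subrr.
have [a1|a1] := eqVneq a 1; first by rewrite T'E a1 scale1r.
(* The trivial coset does not occur in T, as block_perm s u is outside P. *)
have T_eval : ind_unit G rP *m T *m ind_eval G rP = 0.
  apply/row_matrixP => i; rewrite row0 !rowE !mulmxA.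
  have := hT (delta_mx 0 i) 1%g; rewrite tensE.
  have -> : ind_unit G rP *m ind_mx G rP 1%g = ind_unit G rP.
    by rewrite (ind_unitP rP sPG (group1 P)) repr_mx1 mul1mx.
  move=> ->; rewrite -!scalemxAl mulmx_suml big1 ?scaler0 // => u Uu.
  rewrite tensE -!mulmxA (mulmxA (ind_unit G rP)) ind_unit_eval ?inE //.
  rewrite /ext0 mulg1; case: ifP => [Pu|_]; last by rewrite !mulmx0.
  case/negP: (block_perm_off_parabolic k).
  have Pu1 : u \in P by case/setIdP: Uu.
  by rewrite -(groupMr (G := P) _ Pu1).
have quad_a : (q * (1 - a ^+ 2)) *: 1%:M = ((q - 1) * a * (a - 1)) *: T.
  have e1 : T *m T = (q - 1) *: T + q *: 1%:M by rewrite scalemx1.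
  have e2 : a *: T *m (a *: T) = (q - 1) *: (a *: T) + q *: 1%:M by rewrite -T'E scalemx1.
  move: e2; rewrite -scalemxAl -scalemxAr e1 !scalerDr !scalerA => e2.
  have e3 : q *: 1%:M = (a * a * (q - 1)) *: T + (a * a * q) *: 1%:M - ((q - 1) * a) *: T
      :> 'M[C]_(cusp_dim F n r d).
    by rewrite e2 addrAC subrr add0r.
  have -> : q * (1 - a ^+ 2) = q - a * a * q by ring.
  rewrite scalerBl e3 addrAC addrK -scalerBl; congr (_ *: _); ring.
have unit_eval1 : ind_unit G rP *m ind_eval G rP = 1%:M.
  have := ind_unit_eval (G := G) rP (group1 G).
  rewrite (ind_unitP rP sPG (group1 P)) repr_mx1 mul1mx => ->.
  by rewrite /ext0 group1 repr_mx1.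
have : (q * (1 - a ^+ 2)) *: (1%:M : 'M[C]_(tens_dim (fun _ : 'I_n => d))) = 0.
  rewrite -unit_eval1 scalemxAr -[ind_eval G rP]mul1mx scalemxAl quad_a.
  by rewrite -scalemxAl -scalemxAr mulmxA T_eval scaler0.
move/eqP; rewrite scaler_eq0 => /orP[|/eqP one0]; last first.
  apply/eqP; rewrite -subr_eq0; apply/eqP; apply: gen0 => v g.
  by rewrite tensE -[v]mulmx1 one0 mulmx0 !mul0mx.
rewrite mulf_eq0 (negPf q0) /= subr_eq0 eq_sym sqrf_eq1 (negPf a1) /= => /eqP am1.
apply: degen; move: quad_a; rewrite am1 sqrrN expr1n subrr mulr0 scale0r => /esym/eqP.
rewrite scaler_eq0 => /orP[|/eqP//].
have -> : (q - 1) * -1 * (-1 - 1) = (q - 1) * 2%:R by ring.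
rewrite mulf_eq0 pnatr_eq0 orbF subr_eq0 -[1]/(1%:R) eqr_nat => /eqP qq.
by have := ltn_expl r (card_finNzRing_gt1 F); rewrite qq ltnNge r0.
Qed.

Lemma labelled_support la e (X : mx_representation C 'GL_(n * r)[F] e) :
  is_labelled tau la X -> cusp_support tau X.
Proof.
case=> _ [M [modM [_ sim]]] _; have [f freef hom_f] := submod_hom sim.
by exists f => // g; apply: hom_f; rewrite inE.
Qed.

(** An isomorphism between X and X' carries the basis b to a basis of the other Hom
    space, so the matrices A and A' of the action of the T_k are conjugate. *)
Lemma labelled_inj la mu e e' (X : mx_representation C 'GL_(n * r)[F] e)
    (X' : mx_representation C 'GL_(n * r)[F] e') :
  is_partition n la -> is_partition n mu ->
  is_labelled tau la X -> is_labelled tau mu X' -> mx_rsim X X' -> la = mu.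
Proof.
move=> Pla Pmu [_ _ [T [m [b [A [hT [freeb spanb] TA aA]]]]]].
move=> [_ _ [T' [m' [b' [A' [hT' [freeb' spanb'] TA' aA']]]]]] [B ee freeB hB].
subst e'; have uB : B \in unitmx by rewrite -row_free_unit.
have eT k : T' k = T k by exact: hecke_op_unique (hT' k) (hT k).
have bB j : b`_(j : 'I_m) *m B \in <<b'>>%VS.
  apply/spanb' => g; rewrite mulmxA.
  have /spanb -> : b`_j \in <<b>>%VS by apply/memv_span/mem_nth; rewrite size_tuple.
  by rewrite -!mulmxA hB ?inE.
have b'B j : b'`_(j : 'I_m') *m invmx B \in <<b>>%VS.
  apply/spanb => g; rewrite mulmxA.
  have /spanb' -> : b'`_j \in <<b'>>%VS by apply/memv_span/mem_nth; rewrite size_tuple.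
  rewrite -!mulmxA; congr (_ *m _).
  by rewrite -[LHS](mulKmx uB) (mulmxA B) -hB ?inE // -(mulmxA (X g)) mulmxV // mulmx1.
pose Q := \matrix_(i < m', j < m) coord b' i (b`_j *m B).
pose Q' := \matrix_(i < m, j < m') coord b i (b'`_j *m invmx B).
(* Q and its inverse are the base changes between the bases b B and b'. *)
have QQ' : Q *m Q' = 1%:M.
  apply/matrixP => i l; rewrite !mxE.
  transitivity (coord b' i ((\sum_j Q' j l *: b`_j) *m B)).
    rewrite mulmx_suml linear_sum; apply: eq_bigr => j _.
    by rewrite -scalemxAl linearZ /= !mxE mulrC.
  rewrite (eq_bigr (fun j => coord b j (b'`_l *m invmx B) *: b`_j)) => [|j _]; last by rewrite mxE.
  by rewrite -(coord_span (b'B l)) mulmxKV // coord_free // eq_sym.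
have Q'Q : Q' *m Q = 1%:M.
  apply/matrixP => i l; rewrite !mxE.
  transitivity (coord b i ((\sum_j Q j l *: b'`_j) *m invmx B)).
    rewrite mulmx_suml linear_sum; apply: eq_bigr => j _.
    by rewrite -scalemxAl linearZ /= !mxE mulrC.
  rewrite (eq_bigr (fun j => coord b' j (b`_l *m B) *: b'`_j)) => [|j _]; last by rewrite mxE.
  by rewrite -(coord_span (bB l)) mulmxK // coord_free // eq_sym.
have hQ k : A' k *m Q = Q *m A k.
  apply/matrixP => i j; rewrite !mxE.
  transitivity (coord b' i (T k *m (b`_j *m B))).
    rewrite (coord_span (bB j)) mulmx_sumr linear_sum; apply: eq_bigr => l _.
    rewrite -scalemxAr linearZ /= -eT TA' linear_sum (bigD1 i) //= big1 => [|i' ne].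
      by rewrite linearZ /= coord_free // eqxx mulr1 addr0 !mxE mulrC.
    by rewrite linearZ /= coord_free // (negPf ne) mulr0.
  rewrite mulmxA TA mulmx_suml linear_sum; apply: eq_bigr => l _.
  by rewrite -scalemxAl linearZ /= !mxE mulrC.
apply/esym; apply: (attached_inj (q := (#|F| ^ r)%N) _ Pmu Pla aA' aA QQ' Q'Q hQ).
by rewrite expn_gt0 (ltnW (card_finNzRing_gt1 F)).
Qed.

End HeckeOp.

Theorem proposition13p3 (R : realType) (F : finFieldType)
    (t N : nat) (n r d : 'I_t -> nat)
    (tau : forall i, mx_representation R[i] 'GL_(r i)[F] (d i)) :
  (0 < t)%N ->
  (forall i, 0 < n i)%N -> (forall i, 0 < r i)%N ->
  N = (\sum_i n i * r i)%N ->
  (forall i, mx_irreducible (tau i)) ->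
  (forall i, cuspidal (tau i)) ->
  (forall i j, i != j -> ~ GL_rsim (tau i) (tau j)) ->
  (forall (la : {ffun 'I_t -> seq nat}) (e : 'I_t -> nat)
      (V : forall i, mx_representation R[i] 'GL_(n i * r i)[F] (e i)),
    (forall i, is_partition (n i) (la i)) ->
    (forall i, is_labelled (tau i) (la i) (V i)) ->
    mx_irreducible (HC_ind N V)) /\
  (forall (la mu : {ffun 'I_t -> seq nat}) (e e' : 'I_t -> nat)
      (V : forall i, mx_representation R[i] 'GL_(n i * r i)[F] (e i))
      (V' : forall i, mx_representation R[i] 'GL_(n i * r i)[F] (e' i)),
    (forall i, is_partition (n i) (la i)) ->
    (forall i, is_partition (n i) (mu i)) ->
    (forall i, is_labelled (tau i) (la i) (V i)) ->
    (forall i, is_labelled (tau i) (mu i) (V' i)) ->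
    la <> mu ->
    ~ mx_rsim (HC_ind N V) (HC_ind N V')).
Proof.
move=> t0 n0 r0 /esym eN irr_tau cusp_tau nsim.
have N0 : (0 < N)%N.
  by rewrite -eN (bigD1 (Ordinal t0)) //= addn_gt0 muln_gt0 n0 r0.
split=> [la e V _ labV | la mu e e' V V' Pla Pmu labV labV' ne sim].
  apply: (HC_ind_irr n0 r0 N0 eN irr_tau cusp_tau nsim) => i.
    exact: labelled_support (labV i).
  by case: (labV i).
apply: ne; apply/ffunP => i; apply/eqP/negPn/negP => /eqP ne_i.
apply: (HC_ind_components n0 r0 N0 eN irr_tau cusp_tau nsim _ _ _ _ sim (i := i)) => [j|j|j|j|simi].
- exact: labelled_support (labV j).
- by case: (labV j).
- exact: labelled_support (labV' j).
- by case: (labV' j).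
by apply: ne_i; apply: labelled_inj (Pla i) (Pmu i) (labV i) (labV' i) simi.
Qed.
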